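(* Let $F(x)=\sum_{n=0}^\infty |\mathscr{SF}_n/\!\!\sim|\, x^n\in\mathbb{Q}[[x]]$ be the generating function for the numbers of equivalence classes of signed rooted forests with $n$ vertices (with constant term $1$). Then, as formal power series, \[ F(x)=\exp\left(\sum_{k=1}^\infty\frac{x^k}{2k}\left(F(x^{2k})+F(x^k)^2\right)\right). \]
   Context: A rooted forest is a finite acyclic graph in which every connected component has exactly one distinguished vertex, its root; the children of a vertex $i$ are the neighbours of $i$ that are farther than $i$ from the root of the component of $i$. A signed rooted forest $(\mathcal{T},\mathsf{s})$ with vertices $[n]=\{1,\dots,n\}$ is a rooted forest $\mathcal{T}$ with vertex set $[n]$ together with a map $\mathsf{s}\colon E(\mathcal{T})\to\{+,-\}$ on its edges. Two signed rooted forests $(\mathcal{T},\mathsf{s})$, $(\mathcal{T}',\mathsf{s}')$ with vertices $[n]$ are isomorphic if there is a permutation $\pi\in\mathfrak{S}_n$ that sends the roots of $\mathcal{T}$ to the roots of $\mathcal{T}'$ and induces a bijection between the edges preserving the signs. $\mathscr{SF}_n$ denotes the set of isomorphism classes of signed rooted forests with vertices $[n]$. For a vertex $i$, the operation $r_i$ changes simultaneously the signs of all edges connecting $i$ and its children. The equivalence relation $\sim$ on $\mathscr{SF}_n$ is the one generated by the operations $r_i$, $i\in[n]$ (i.e. two isomorphism classes are equivalent if representatives are related by a finite sequence of isomorphisms and operations $r_i$). For $n=0$ the only forest is the empty forest, so $|\mathscr{SF}_0/\!\!\sim|=1$. *)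

(* Defs.v *)
From HB Require Import structures.
From mathcomp Require Import all_boot all_order all_algebra all_fingroup.
Set Implicit Arguments.
Unset Strict Implicit.
Unset Printing Implicit Defensive.
Import GRing.Theory.
Local Open Scope ring_scope.

(* A graph on the vertices 'I_n with a set of marked vertices (roots) and     *)
(* signed edges. Edges are two-element sets of vertices (see is_srforest) and *)
(* the sign map is given by the set of edges on which it takes the value -.   *)
Record srgraph (n : nat) := SRGraph {
  edges : {set {set 'I_n}};
  roots : {set 'I_n};
  negs : {set {set 'I_n}}
}.

Definition srgraph_code n (g : srgraph n) := (edges g, roots g, negs g).
Definition srgraph_decode n
    (c : {set {set 'I_n}} * {set 'I_n} * {set {set 'I_n}}) :=
  SRGraph c.1.1 c.1.2 c.2.

Lemma srgraph_codeK n : cancel (@srgraph_code n) (@srgraph_decode n).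
Proof. by case. Qed.

HB.instance Definition _ n :=
  Countable.copy (srgraph n) (can_type (@srgraph_codeK n)).
HB.instance Definition _ n : isFinite (srgraph n) :=
  CanIsFinite (@srgraph_codeK n).

Definition adj n (g : srgraph n) : rel 'I_n :=
  fun x y => [set x; y] \in edges g.

(* Simple cycles have at most n vertices, so sequences of length <= n suffice. *)
Definition acyclic n (g : srgraph n) : bool :=
  [forall c : n.-bseq 'I_n, ucycleb (adj g) c ==> (size c <= 2)%N].

Definition is_srforest n (g : srgraph n) : bool :=
  [&& [forall e in edges g, #|e| == 2],
      negs g \subset edges g,
      acyclic g
    & [forall x, #|[set r in roots g | connect (adj g) x r]| == 1]].

Definition srforests n : {set srgraph n} := [set g | is_srforest g].

Definition walk n (g : srgraph n) (k : nat) (x y : 'I_n) : bool :=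
  [exists p : k.-tuple 'I_n, path (adj g) x p && (last x p == y)].

(* Graph distance; its value is n if x and y are not connected. *)
Definition dist n (g : srgraph n) (x y : 'I_n) : nat :=
  find (fun k => walk g k x y) (iota 0 n).

Definition children n (g : srgraph n) (i : 'I_n) : {set 'I_n} :=
  [set j | adj g i j &&
     [exists r in roots g,
        connect (adj g) r i && (dist g r i < dist g r j)%N]].

Definition child_edges n (g : srgraph n) (i : 'I_n) : {set {set 'I_n}} :=
  [set [set i; j] | j in children g i].

(* The operation r_i: the new set of negative edges is the symmetric          *)
(* difference of the old one and of the set of edges from i to its children.  *)
Definition flip n (i : 'I_n) (g : srgraph n) : srgraph n :=
  SRGraph (edges g) (roots g)
    ((negs g :\: child_edges g i) :|: (child_edges g i :\: negs g)).

Definition iso n : rel (srgraph n) := fun g h =>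
  [exists pi : {perm 'I_n},
    [&& pi @: roots g == roots h,
        [set pi @: (e : {set 'I_n}) | e in edges g] == edges h
      & [set pi @: (e : {set 'I_n}) | e in negs g] == negs h]].

Definition SF n : {set {set srgraph n}} :=
  equivalence_partition (@iso n) (srforests n).

Definition flip_step n : rel {set srgraph n} := fun C D =>
  [&& C \in SF n, D \in SF n &
      [exists g in C, exists i : 'I_n, flip i g \in D]].

(* The equivalence relation on SF n generated by flip_step. *)
Definition flip_equiv n : rel {set srgraph n} :=
  connect (fun C D => flip_step C D || flip_step D C).

Definition SF_classes n : {set {set {set srgraph n}}} :=
  equivalence_partition (@flip_equiv n) (SF n).

(* Formal power series over rat, as sequences of coefficients. *)
Definition fps := nat -> rat.

Definition fps_monom (k : nat) : fps := fun n => (n == k)%:R.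
Definition fps_add (a b : fps) : fps := fun n => a n + b n.
Definition fps_scale (c : rat) (a : fps) : fps := fun n => c * a n.
Definition fps_mul (a b : fps) : fps :=
  fun n => \sum_(i < n.+1) a i * b (n - i)%N.
Definition fps_pow (a : fps) (k : nat) : fps :=
  iter k (fps_mul a) (fps_monom 0).

(* a(x^m), for m > 0 *)
Definition fps_subst (m : nat) (a : fps) : fps :=
  fun n => if (m %| n)%N then a (n %/ m)%N else 0.

(* The sum of the series a k for k >= m, when x^k divides a k for all these k: *)
(* the coefficient of x^n then only involves the terms with k <= n; see        *)
(* fps_sumE.                                                                   *)
Definition fps_sum (m : nat) (a : nat -> fps) : fps :=
  fun n => \sum_(m <= k < n.+1) a k n.

(* exp(a) = \sum_k a^k / k!, for a without constant term *)
Definition fps_exp (a : fps) : fps :=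
  fps_sum 0 (fun k => fps_scale (k`!%:R)^-1 (fps_pow a k)).

Lemma fps_sumE m (a : nat -> fps) :
  (forall k n, (m <= k)%N -> (n < k)%N -> a k n = 0) ->
  forall n N, (n < N)%N -> \sum_(m <= k < N) a k n = fps_sum m a n.
Proof.
move=> a0 n N ltnN; rewrite /fps_sum.
have [lemn|ltnm] := leqP m n.+1.
  rewrite (big_cat_nat lemn ltnN) /= [X in _ + X]big_nat [X in _ + X]big1 ?addr0 //.
  by move=> k /andP[ltnk _]; rewrite a0 // (leq_trans lemn).
rewrite [RHS]big_geq 1?ltnW // big_nat big1 // => k /andP[lemk _].
by rewrite a0 // (leq_trans _ lemk) // ltnW.
Qed.

Lemma fps_pow_eq0 (a : fps) k n : a 0%N = 0 -> (n < k)%N -> fps_pow a k n = 0.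
Proof.
move=> a0; elim: k n => // k IHk n ltnk.
rewrite /fps_pow iterS -/(fps_pow a k) /fps_mul big1 // => -[[|i] ltin] _ /=.
  by rewrite a0 mul0r.
rewrite [X in _ * X]IHk ?mulr0 //; rewrite ltnS in ltin.
by rewrite ltn_subLR // addSn -addnS (leq_trans ltnk) // leq_addl.
Qed.

Lemma fps_monom_mul_eq0 (a : fps) k n :
  (n < k)%N -> fps_mul (fps_monom k) a n = 0.
Proof.
move=> ltnk; rewrite /fps_mul big1 // => i _; rewrite /fps_monom.
by rewrite ltn_eqF ?mul0r // (leq_ltn_trans _ ltnk) // -ltnS.
Qed.

Definition F : fps := fun n => #|SF_classes n|%:R.

(* Main.v *)
Require Import Defs.
From HB Require Import structures.
From mathcomp Require Import all_boot all_order all_algebra all_fingroup.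
From mathcomp Require Import zify ring.
Set Implicit Arguments.
Unset Strict Implicit.
Unset Printing Implicit Defensive.
Import GRing.Theory Num.Theory.
Local Open Scope ring_scope.

(** A signed rooted forest is, up to isomorphism and sign reversals, a multiset of
trees, and a tree is a root below which hang two forests, one for each sign. As
reversing the signs at the root exchanges these two forests, while the reversals
at the other vertices act inside them, a class of trees is an unordered pair of
classes of forests. With T the generating function of the classes of trees, this
gives T = x (F(x)^2 + F(x^2)) / 2, and the multisets of trees are counted by
F = exp(T(x) + T(x^2)/2 + T(x^3)/3 + ...), which is the formula.

The classes are identified with canonical codes, which are sorted lists of sorted
pairs of codes. The code of a forest is computed from its parent function. It is
invariant under isomorphisms and reversals ([pcode_embed]), complete
([pcode_complete], where an isomorphism is built from the roots down by matching
vertices with equal codes), and each canonical code is attained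
([canon_attained]). Graphs come in through [graph_of_orient]: in an acyclic graph
with one root in each component, every vertex other than a root has exactly one
neighbour closer to the root, and all edges arise in this way ([closer_uniq]).
Hence |SF_n/~| is the number of canonical codes of size n ([card_SF_classes]).

Canonical codes are counted by recurrences. Twice the number of unordered pairs is
the number of ordered pairs plus the number of diagonal ones ([size_tr]). For
multisets, counting the triples of a forest, a tree in it and a vertex of that
tree gives n f(n) = \sum m t(m) f(n - j m), summed over j, m > 0 ([size_fo]); this
is the logarithmic derivative of the exponential formula, and a power series is
determined by its logarithmic derivative and its constant term
([fps_exp_unique]). *)

(** * Formal power series: the exponential through its logarithmic derivative *)

(** Up to a given degree, the product of series is the product of polynomials,
so identities of products can be imported from the ring of polynomials. *)
Lemma fps_mulE (a b : fps) N n : (n <= N)%N ->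
  fps_mul a b n = ((\poly_(i < N.+1) a i) * (\poly_(i < N.+1) b i))`_n.
Proof.
move=> nN; rewrite coefM /fps_mul; apply: eq_bigr => i _.
by rewrite !coef_poly !ltnS (leq_trans (leq_subr _ _) nN)
  (leq_trans _ nN) // -ltnS.
Qed.

Lemma fps_mulCA (a b c : fps) n :
  fps_mul a (fps_mul b c) n = fps_mul b (fps_mul a c) n.
Proof.
have assoc (u v w : fps) : fps_mul u (fps_mul v w) n =
    ((\poly_(i < n.+1) u i) *
      ((\poly_(i < n.+1) v i) * (\poly_(i < n.+1) w i)))`_n.
  rewrite coefM; apply: eq_bigr => i _.
  rewrite coef_poly ltn_ord; congr (_ * _).
  by apply: fps_mulE; apply: leq_subr.
by rewrite !assoc mulrCA.
Qed.

(** The operator x d/dx. *)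
Definition fps_theta (a : fps) : fps := fun n => n%:R * a n.

Lemma fps_theta_mul (a b : fps) n : fps_theta (fps_mul a b) n =
  fps_mul (fps_theta a) b n + fps_mul a (fps_theta b) n.
Proof.
rewrite /fps_theta /fps_mul -big_split mulr_sumr; apply: eq_bigr => i _ /=.
have -> : n%:R = i%:R + (n - i)%N%:R :> rat by rewrite -natrD subnKC // -ltnS.
by ring.
Qed.

Lemma eq_fps_mul (a b b' : fps) : b =1 b' -> fps_mul a b =1 fps_mul a b'.
Proof. by move=> eqb n; apply: eq_bigr => i _; rewrite eqb. Qed.

Lemma fps_theta_pow (a : fps) k n : fps_theta (fps_pow a k.+1) n =
  k.+1%:R * fps_mul (fps_theta a) (fps_pow a k) n.
Proof.
elim: k n => [|k IHk] n; rewrite /fps_pow iterS -/(fps_pow a _) fps_theta_mul.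
  rewrite mul1r [X in _ + X]big1 ?addr0 // => i _.
  rewrite /fps_theta /fps_pow /fps_monom /=.
  by case: (n - i)%N => [|m]; rewrite !(mul0r, mulr0).
have -> : fps_mul a (fps_theta (fps_pow a k.+1)) n =
    k.+1%:R * fps_mul a (fps_mul (fps_theta a) (fps_pow a k)) n.
  rewrite (eq_fps_mul _ IHk) /fps_mul mulr_sumr.
  by apply: eq_bigr => i _; rewrite mulrCA.
by rewrite fps_mulCA [k.+2%:R]mulrSr mulrDl mul1r addrC.
Qed.

Lemma fps_exp0 (a : fps) : fps_exp a 0%N = 1.
Proof. by rewrite /fps_exp /fps_sum big_nat1 /fps_scale invr1 mulr1. Qed.

(** Term by term, x d/dx (a^k / k!) = (x d/dx a) a^(k-1) / (k-1)!. *)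
Lemma fps_theta_exp (a : fps) n : a 0%N = 0 ->
  fps_theta (fps_exp a) n = fps_mul (fps_theta a) (fps_exp a) n.
Proof.
move=> a0; rewrite /fps_theta /fps_exp /fps_sum mulr_sumr big_nat_recl //=.
rewrite [X in X + _](_ : _ = 0) ?add0r; last first.
  rewrite /fps_scale /fps_pow /fps_monom /=.
  by case: n => [|n]; rewrite ?mul0r // !mulr0.
transitivity (\sum_(0 <= k < n) (k`!%:R)^-1 *
                fps_mul (fps_theta a) (fps_pow a k) n).
  apply: eq_bigr => k _; rewrite /fps_scale mulrCA.
  have -> : n%:R * fps_pow a k.+1 n = fps_theta (fps_pow a k.+1) n by [].
  rewrite fps_theta_pow mulrA; congr (_ * _).
  by rewrite factS natrM invfM mulrAC mulVf ?mul1r // pnatr_eq0.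
rewrite /fps_mul; under eq_bigr do rewrite mulr_sumr.
rewrite exchange_big /=; apply: eq_bigr => -[i ltin] _ /=.
under eq_bigr do rewrite mulrCA.
rewrite -mulr_sumr; case: i ltin => [|i] ltin; first by rewrite /fps_theta !mul0r.
congr (_ * _); apply: (@fps_sumE 0 (fun k => fps_scale (k`!%:R)^-1 (fps_pow a k))).
  by move=> k m _ ltmk; rewrite /fps_scale fps_pow_eq0 ?mulr0.
by rewrite subnS prednK ?leq_subr // subn_gt0.
Qed.

(** The equation gives the coefficient of degree n > 0 from those of lower degree,
since x d/dx a has no constant term. *)
Lemma fps_exp_unique (a f : fps) : a 0%N = 0 -> f 0%N = 1 ->
  (forall n, fps_theta f n = fps_mul (fps_theta a) f n) -> f =1 fps_exp a.
Proof.
move=> a0 f0 thf n; have [m] := ubnP n; elim: m n => // m IHm [|n] ltnm.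
  by rewrite fps_exp0.
have n0 : n.+1%:R != 0 :> rat by rewrite pnatr_eq0.
apply: (mulfI n0); have := thf n.+1; rewrite /fps_theta => ->.
have := fps_theta_exp n.+1 a0; rewrite /fps_theta => ->.
rewrite /fps_mul; apply: eq_bigr => -[[|i] ltin] _ /=; first by rewrite !mul0r.
by rewrite IHm // subSS (leq_ltn_trans (leq_subr _ _)).
Qed.

(** * Canonical codes of forests up to isomorphism and sign reversal *)

(** A code is a list of trees, a tree being the pair of the codes of the forests
that hang from its root by edges of either sign; [CCons a b x] is the tree
[(a, b)] followed by the trees of [x]. *)
Inductive code := CNil | CCons of code & code & code.

Fixpoint code_tree (x : code) : GenTree.tree unit :=
  if x is CCons a b y
  then GenTree.Node 0 [:: code_tree a; code_tree b; code_tree y]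
  else GenTree.Leaf tt.

Fixpoint tree_code (t : GenTree.tree unit) : code :=
  if t is GenTree.Node _ [:: a; b; y]
  then CCons (tree_code a) (tree_code b) (tree_code y) else CNil.

Lemma code_treeK : cancel code_tree tree_code.
Proof. by elim=> //= a -> b -> y ->. Qed.

HB.instance Definition _ := Countable.copy code (can_type code_treeK).

(** An arbitrary total order, by which multisets have a normal form. *)
Definition ple (T : countType) : rel T := fun x y => (pickle x <= pickle y)%N.

Lemma ple_total T : total (@ple T).
Proof. by move=> x y; apply: leq_total. Qed.

Lemma ple_trans T : transitive (@ple T).
Proof. by move=> y x z; apply: leq_trans. Qed.

Lemma ple_anti T : antisymmetric (@ple T).
Proof.
move=> x y /andP[xy yx]; apply: (pcan_inj (@pickleK T)).
by apply/eqP; rewrite eqn_leq; apply/andP.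
Qed.

Lemma ple_sortP (T : countType) (s t : seq T) :
  reflect (sort (@ple T) s = sort (@ple T) t) (perm_eq s t).
Proof.
exact: (perm_sortP (@ple_total T) (@ple_trans T) (@ple_anti T)).
Qed.

Lemma sort_ple_id (T : countType) (s : seq T) :
  sorted (@ple T) s -> sort (@ple T) s = s.
Proof. exact: (sorted_sort (@ple_trans T)). Qed.

Definition ctree := (code * code)%type.

Fixpoint trees (x : code) : seq ctree :=
  if x is CCons a b y then (a, b) :: trees y else [::].

Fixpoint of_trees (s : seq ctree) : code :=
  if s is (a, b) :: s' then CCons a b (of_trees s') else CNil.

Lemma of_treesK : cancel of_trees trees.
Proof. by elim=> //= -[a b] s /= ->. Qed.

Lemma treesK : cancel trees of_trees.
Proof. by elim=> //= a _ b _ y ->. Qed.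

Fixpoint csize (x : code) : nat :=
  if x is CCons a b y then (csize a + csize b + csize y).+1 else 0.

Definition tree_size (t : ctree) : nat := (csize t.1 + csize t.2).+1.

Lemma csizeE x : csize x = \sum_(t <- trees x) tree_size t.
Proof.
elim: x => [|a _ b _ y IHy] /=; first by rewrite big_nil.
by rewrite big_cons -IHy.
Qed.

(** A forest is a multiset of trees and, since the signs at its root can be
reversed, a tree is an unordered pair of forests: these are represented by
sorted lists and sorted pairs. *)
Fixpoint canon (x : code) : bool :=
  if x is CCons a b y
  then [&& canon a, canon b, ple a b, canon y & path (@ple _) (a, b) (trees y)]
  else true.

Definition canonT (t : ctree) := [&& canon t.1, canon t.2 & ple t.1 t.2].

Lemma canonE x : canon x = all canonT (trees x) && sorted (@ple _) (trees x).
Proof.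
elim: x => //= a _ b _ y ->; rewrite /canonT /=.
case: (canon a) => //=; case: (canon b) => //=; case: (ple a b) => //=.
case: (all _ _) => //=; case: (trees y) => //= t s.
by case: (path _ t s); rewrite ?andbF.
Qed.

Definition forest_code (s : seq ctree) : code := of_trees (sort (@ple _) s).
Definition tree_of (a b : code) : ctree := if ple a b then (a, b) else (b, a).

Lemma tree_ofC a b : tree_of a b = tree_of b a.
Proof.
rewrite /tree_of; have := @ple_anti _ a b; have := ple_total a b.
by case: (ple a b); case: (ple b a) => //= _ /(_ isT) ->.
Qed.

Lemma tree_of_inj a b c d : tree_of a b = tree_of c d ->
  (a = c /\ b = d) \/ (a = d /\ b = c).
Proof. by rewrite /tree_of; do 2!case: ifP => _; case=> -> ->; auto. Qed.

Lemma canon_tree_of a b : canon a -> canon b -> canonT (tree_of a b).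
Proof.
move=> ca cb; rewrite /tree_of /canonT; have := ple_total a b.
by case: ifP => [ab _|_ /= ba] /=; rewrite ca cb /= ?ab ?ba.
Qed.

Lemma tree_of_id a b : ple a b -> tree_of a b = (a, b).
Proof. by rewrite /tree_of => ->. Qed.

Lemma tree_size_tree_of a b : tree_size (tree_of a b) = (csize a + csize b).+1.
Proof. by rewrite /tree_of; case: ifP; rewrite /tree_size //= addnC. Qed.

Lemma forest_codeP s t : reflect (forest_code s = forest_code t) (perm_eq s t).
Proof.
apply: (iffP (ple_sortP s t)) => [|/(can_inj of_treesK)//].
by rewrite /forest_code => ->.
Qed.

Lemma perm_trees_forest_code s : perm_eq (trees (forest_code s)) s.
Proof. by rewrite of_treesK perm_sort. Qed.

Lemma canon_forest_code s : all canonT s -> canon (forest_code s).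
Proof.
move=> cs; rewrite canonE (perm_all _ (perm_trees_forest_code s)) cs /=.
by rewrite of_treesK sort_sorted //; apply: ple_total.
Qed.

Lemma forest_code_id x : canon x -> forest_code (trees x) = x.
Proof.
by rewrite canonE /forest_code => /andP[_ sx]; rewrite sort_ple_id ?treesK.
Qed.

Lemma csize_forest_code s : csize (forest_code s) = \sum_(t <- s) tree_size t.
Proof. by rewrite csizeE (perm_big _ (perm_trees_forest_code s)). Qed.

Lemma canon_perm_inj x y :
  canon x -> canon y -> perm_eq (trees x) (trees y) -> x = y.
Proof.
by move=> cx cy /forest_codeP; rewrite !forest_code_id.
Qed.

(** * Counting canonical codes *)

Section CountCodes.

Variable fo : nat -> seq code.
Hypothesis uniq_fo : forall n, uniq (fo n).
Hypothesis mem_fo : forall n x, (x \in fo n) = canon x && (csize x == n).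

Definition code_pairs m : seq ctree :=
  [seq p | i <- iota 0 m.+1, p <- [seq (a, b) | a <- fo i, b <- fo (m - i)]].

Lemma mem_code_pairs m p :
  (p \in code_pairs m) = [&& canon p.1, canon p.2 & tree_size p == m.+1].
Proof.
case: p => a b /=; apply/allpairsPdep/and3P => [[i [p [im]]]|].
  case/allpairsP => -[c d] /= []; rewrite !mem_fo.
  move=> /andP[cc /eqP sc] /andP[cd /eqP sd] -> [-> ->].
  split=> //; rewrite mem_iota add0n ltnS in im.
  by rewrite /tree_size /= sc sd subnKC.
rewrite /tree_size eqSS => -[ca cb /eqP sab].
exists (csize a), (a, b); split=> //.
  by rewrite mem_iota leq0n ltnS -sab leq_addr.
apply/allpairsP; exists (a, b); split=> //=; rewrite mem_fo ?ca ?cb //=.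
by rewrite -sab addKn.
Qed.

Lemma uniq_code_pairs m : uniq (code_pairs m).
Proof.
apply: allpairs_uniq_dep => [|i _|].
- exact: iota_uniq.
- by apply: allpairs_uniq => // -[a b] [c d].
move=> _ _ /allpairsPdep[i [p [_ ip ->]]] /allpairsPdep[j [q [_ jq ->]]] /= pq.
case/allpairsP: ip => -[a b] /= [ai _ pE].
case/allpairsP: jq => -[c d] /= [cj _ qE].
move: ai cj; rewrite !mem_fo => /andP[_ /eqP <-] /andP[_ /eqP <-].
by move: pE; rewrite pq qE => -[-> ->].
Qed.

Lemma size_code_pairs m :
  size (code_pairs m) = (\sum_(i < m.+1) size (fo i) * size (fo (m - i)))%N.
Proof.
rewrite size_allpairs_dep sumnE big_map -[iota 0 _]/(index_iota 0 m.+1).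
by rewrite big_mkord; apply: eq_bigr => i _; rewrite size_allpairs.
Qed.

Definition tr m : seq ctree :=
  if m is m'.+1 then [seq p <- code_pairs m' | ple p.1 p.2] else [::].

Lemma mem_tr m t : (t \in tr m) = canonT t && (tree_size t == m).
Proof.
case: m => [|m]; first by rewrite andbF.
by rewrite mem_filter mem_code_pairs /canonT andbC -!andbA; do 2!congr (_ && _); apply: andbC.
Qed.

Lemma uniq_tr m : uniq (tr m).
Proof. by case: m => // m; apply/filter_uniq/uniq_code_pairs. Qed.

(** Each unordered pair comes from two ordered pairs, except for the pairs on
the diagonal. *)
Lemma size_tr m : (2 * size (tr m.+1) =
  \sum_(i < m.+1) size (fo i) * size (fo (m - i)) +
  (if 2 %| m then size (fo (m %/ 2)) else 0))%N.
Proof.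
rewrite -size_code_pairs /tr size_filter; set P := code_pairs m.
have swapP : count (fun p => ple p.2 p.1) P = count (fun p => ple p.1 p.2) P.
  pose sw (p : ctree) : ctree := (p.2, p.1).
  have swK : involutive sw by case.
  rewrite -[LHS](@count_map _ _ sw (fun p => ple p.1 p.2)).
  suff /seq.permP -> : perm_eq [seq sw p | p <- P] P by [].
  apply: uniq_perm.
  - by rewrite (map_inj_uniq (can_inj swK)) uniq_code_pairs.
  - exact: uniq_code_pairs.
  move=> p; rewrite -[p in LHS]swK (mem_map (can_inj swK)) !mem_code_pairs.
  by rewrite /tree_size /= addnC andbCA.
rewrite mul2n -addnn -{2}swapP -count_predUI; congr (_ + _)%N.
  rewrite -[RHS]count_predT; apply: eq_count => p /=; exact: ple_total.
rewrite (_ : count _ P = count (fun p => p.1 == p.2) P); last first.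
  apply: eq_count => p /=; apply/idP/eqP => [|->]; first exact: ple_anti.
  by rewrite /ple leqnn.
rewrite -size_filter; case: ifP => [m2|m2].
  rewrite -(size_map (fun x => (x, x)) (fo _)); apply/perm_size/uniq_perm.
  - exact/filter_uniq/uniq_code_pairs.
  - by rewrite map_inj_uniq // => x y [].
  move=> [a b]; rewrite mem_filter mem_code_pairs /tree_size eqSS /=.
  apply/andP/mapP => [[/eqP<- /and3P[ca _ /eqP sa]]|[x]].
    by exists a => //; rewrite mem_fo ca -sa addnn -muln2 mulnK //=.
  rewrite mem_fo => /andP[cx /eqP sx] [-> ->]; rewrite eqxx cx sx; split=> //=.
  by rewrite addnn -muln2 divnK.
apply/eqP; rewrite size_eq0 -[_ == _]negbK -has_filter; apply/negP => /hasP[[a b]].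
rewrite mem_code_pairs /tree_size eqSS /= => /and3P[_ _ /eqP sab] /eqP abE.
by move: m2; rewrite -sab abE addnn -muln2 dvdn_mull.
Qed.

(** The vertices of a forest, sorted by the size and the isomorphism type of the
tree to which they belong. *)
Lemma csize_tr n x : x \in fo n ->
  n = (\sum_(1 <= m < n.+1) \sum_(t <- tr m) count_mem t (trees x) * m)%N.
Proof.
rewrite mem_fo canonE => /andP[/andP[cx _] /eqP sx].
rewrite -{1}sx csizeE; have : all (fun t => canonT t && (tree_size t <= n)%N) (trees x).
  rewrite -sx csizeE; apply/allP => t tx; rewrite (allP cx) //=.
  by rewrite (big_rem t) //= leq_addr.
elim: (trees x) => [_|t s IHs /= /andP[/andP[ct tn] /IHs sE]].
  by rewrite big_nil !big1 // => m _; rewrite big1.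
rewrite big_cons sE.
transitivity (\sum_(1 <= m < n.+1) (tree_size t == m) * m +
  \sum_(1 <= m < n.+1) \sum_(t' <- tr m) count_mem t' s * m)%N; last first.
  rewrite -big_split; apply: eq_bigr => m _ /=.
  under [RHS]eq_bigr do rewrite mulnDl.
  rewrite big_split; congr (_ + _)%N; rewrite -big_distrl /=; congr (_ * _)%N.
  have -> : (tree_size t == m) = (t \in tr m) by rewrite mem_tr ct.
  rewrite -(count_uniq_mem _ (uniq_tr m)) -sum1_count [LHS]big_mkcond /=.
  by apply: eq_bigr => t' _; rewrite eq_sym; case: eqP.
congr (_ + _)%N; rewrite (bigD1_seq (tree_size t)) ?iota_uniq ?mem_index_iota //=.
by rewrite eqxx mul1n big1 ?addn0 // => m /negPf; rewrite eq_sym => ->.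
Qed.

(** Adding [j] copies of a tree [t] is a bijection onto the codes that contain
[t] at least [j] times. *)
Lemma count_tree n j m t : t \in tr m ->
  count (fun x => j <= count_mem t (trees x))%N (fo n) =
  (if j * m <= n then size (fo (n - j * m)) else 0)%N.
Proof.
rewrite mem_tr => /andP[ct /eqP st].
pose add x := forest_code (nseq j t ++ trees x).
have sadd x : csize (add x) = (j * m + csize x)%N.
  rewrite csize_forest_code big_cat /= -csizeE; congr (_ + _)%N.
  by elim: (j) => [|i IHi]; rewrite ?big_nil // big_cons IHi st.
have trees_add x : perm_eq (trees (add x)) (nseq j t ++ trees x).
  exact: perm_trees_forest_code.
have cadd x : canon x -> canon (add x).
  rewrite canonE => /andP[cx _]; apply: canon_forest_code.
  by rewrite all_cat cx all_nseq ct orbT.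
have adjoin x : canon x -> (j <= count_mem t (trees x))%N ->
    exists2 y, canon y & x = add y.
  move=> cx tx; have cxs : all canonT (trees x) by move: cx; rewrite canonE => /andP[].
  pose s := nseq (count_mem t (trees x) - j) t ++
            [seq u <- trees x | u != t].
  have ps : perm_eq (trees x) (nseq j t ++ s).
    rewrite catA -nseqD subnKC // -(perm_filterC (pred1 t)).
    rewrite perm_cat2r -size_filter.
    by have /all_pred1P <- := filter_all (pred1 t) (trees x).
  have cs : all canonT s by move: cxs; rewrite (perm_all _ ps) all_cat => /andP[].
  exists (forest_code s); first exact: canon_forest_code.
  apply: canon_perm_inj; rewrite ?cadd ?canon_forest_code //.
  rewrite (permPl ps) perm_sym (permPl (trees_add _)) perm_cat2l.
  exact: perm_trees_forest_code.
rewrite -size_filter; case: ifP => [jn|/negbT]; last first.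
  rewrite -ltnNge => jn; apply/eqP; rewrite size_eq0 -[_ == _]negbK -has_filter.
  apply/negP => /hasP[x]; rewrite mem_fo => /andP[cx /eqP sx] /(adjoin _ cx)[y _ xE].
  by move: jn; rewrite -sx xE sadd ltnNge leq_addr.
rewrite -(size_map add (fo _)); apply/perm_size/uniq_perm.
- exact: filter_uniq.
- rewrite map_inj_in_uniq // => x y; rewrite !mem_fo => /andP[cx _] /andP[cy _] xy.
  apply: canon_perm_inj => //; rewrite -(perm_cat2l (nseq j t)).
  by rewrite -(permPl (trees_add x)) -(permPr (trees_add y)) xy.
move=> x; rewrite mem_filter mem_fo; apply/and3P/mapP => [[tx cx /eqP sx]|[y yn ->]].
  have [y cy xE] := adjoin x cx tx; exists y => //.
  by rewrite mem_fo cy -sx xE sadd addKn /=.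
move: yn; rewrite mem_fo => /andP[cy /eqP sy].
rewrite cadd // sadd sy subnKC // (seq.permP (trees_add y)) count_cat count_nseq /= eqxx.
by rewrite mul1n leq_addr.
Qed.

(** Both sides count the triples of a forest with [n] vertices, one of its trees
and a vertex of that tree; on the right-hand side the tree has [m] vertices and
[j] numbers it among the trees of the forest that are isomorphic to it. *)
Lemma size_fo n : (n * size (fo n) =
  \sum_(1 <= m < n.+1) \sum_(1 <= j < n.+1)
    (if j * m <= n then m * size (tr m) * size (fo (n - j * m)) else 0))%N.
Proof.
transitivity (\sum_(x <- fo n)
  \sum_(1 <= m < n.+1) \sum_(t <- tr m) count_mem t (trees x) * m)%N.
  rewrite -sum1_size big_distrr big_seq [RHS]big_seq /=.
  by apply: eq_bigr => x /csize_tr; rewrite muln1.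
rewrite exchange_big; apply: eq_bigr => m _ /=.
have countE t x : t \in tr m -> x \in fo n ->
    count_mem t (trees x) = (\sum_(1 <= j < n.+1) (j <= count_mem t (trees x)))%N.
  move=> _; rewrite mem_fo csizeE => /andP[_ /eqP sx].
  have : (count_mem t (trees x) <= n)%N.
    rewrite (leq_trans (count_size _ _)) // -sx -sum1_size.
    by apply: leq_sum => u _.
  move: (count_mem _ _) => c cn; rewrite (big_cat_nat (n := c.+1)) //=.
  rewrite big_nat [X in (_ + X)%N]big_nat [X in (_ + X)%N]big1; last first.
    by move=> j /andP[cj _]; rewrite leqNgt cj.
  rewrite addn0 (eq_bigr (fun=> 1%N)); last by move=> j /andP[_]; rewrite ltnS => ->.
  by rewrite -big_nat sum_nat_const_nat muln1 subn1.
transitivity (\sum_(x <- fo n) \sum_(t <- tr m) \sum_(1 <= j < n.+1)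
                (j <= count_mem t (trees x)) * m)%N.
  rewrite big_seq [RHS]big_seq; apply: eq_bigr => x xn.
  rewrite big_seq [RHS]big_seq; apply: eq_bigr => t tm.
  by rewrite -big_distrl /= -countE.
rewrite exchange_big /=; under eq_bigr do rewrite exchange_big /=.
rewrite exchange_big /=; apply: eq_bigr => j _.
rewrite big_seq (eq_bigr (fun=> m *
    if j * m <= n then size (fo (n - j * m)) else 0))%N; last first.
  move=> t tm; rewrite -big_distrl /= mulnC; congr (_ * _)%N.
  by rewrite -(count_tree _ _ tm) -sum1_count [RHS]big_mkcond.
rewrite -big_seq (_ : \sum_(t <- tr m) _ = size (tr m) *
    (m * if j * m <= n then size (fo (n - j * m)) else 0))%N.
  by case: ifP => _; rewrite ?muln0 // mulnCA mulnA.
by rewrite -(sum1_size (tr m)) big_distrl; apply: eq_bigr => t _ /=; rewrite mul1n.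
Qed.

End CountCodes.

(** * From the recurrences to the functional equation *)

(** Reindexing by i = k m. *)
Lemma sum_multiples (k N : nat) (g : nat -> rat) : (0 < k)%N ->
  \sum_(i < N) (if (k %| i)%N then g i else 0) =
  \sum_(m < N) (if (k * m < N)%N then g (k * m)%N else 0).
Proof.
move=> k0; transitivity (\sum_(i < N) \sum_(m < N)
                           (if (k * m)%N == i :> nat then g i else 0)).
  apply: eq_bigr => i _; rewrite -big_mkcond; case: ifP => [/dvdnP[m iE]|ki].
    have mN : (m < N)%N.
      by apply: leq_ltn_trans (ltn_ord i); rewrite iE leq_pmulr.
    rewrite (big_pred1 (Ordinal mN)) // => j /=.
    by rewrite iE mulnC eqn_pmul2r.
  by rewrite big1 // => m /eqP kmi; rewrite -kmi dvdn_mulr in ki.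
rewrite exchange_big; apply: eq_bigr => m _ /=; rewrite -big_mkcond /=.
case: ifP => kmN; first by rewrite (big_pred1 (Ordinal kmN)) // => j /=; rewrite eq_sym.
by rewrite big1 // => i /eqP kmi; rewrite kmi ltn_ord in kmN.
Qed.

Lemma fps_mul_monom (k : nat) (a : fps) n :
  fps_mul (fps_monom k) a n = if (k <= n)%N then a (n - k)%N else 0.
Proof.
case: leqP => [kn|]; last exact: fps_monom_mul_eq0.
rewrite /fps_mul /fps_monom (bigD1 (Ordinal (kn : (k < n.+1)%N))) //= eqxx mul1r.
by rewrite big1 ?addr0 // => i /negPf; rewrite -val_eqE /= => ->; rewrite mul0r.
Qed.

Lemma fps_pow2 (a : fps) n : fps_pow a 2 n = fps_mul a a n.
Proof.
apply: eq_fps_mul => {}n; rewrite /= /fps_mul big_ord_recr /= subnn mulr1.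
rewrite big1 ?add0r // => i _; rewrite /fps_monom.
by rewrite subn_eq0 leqNgt ltn_ord mulr0.
Qed.

Lemma fps_subst_mul k (a b : fps) n : (0 < k)%N ->
  fps_mul (fps_subst k a) (fps_subst k b) n = fps_subst k (fps_mul a b) n.
Proof.
move=> k0; rewrite {1}/fps_mul /fps_subst.
have [/dvdnP[m ->]|kn] := boolP (k %| n)%N; last first.
  rewrite big1 // => i _; case: ifP => [ki|]; rewrite ?mul0r //.
  rewrite (_ : (k %| n - i)%N = false) ?mulr0 //.
  by apply: contraNF kn => /(dvdn_add ki); rewrite subnKC // -ltnS.
transitivity (\sum_(i < (m * k).+1) (if (k %| i)%N then
    a (i %/ k)%N * b (m - i %/ k)%N else 0)).
  apply: eq_bigr => i _; case: ifP => [/dvdnP[j ->]|]; rewrite ?mul0r //.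
  by rewrite -mulnBl dvdn_mull // !mulnK.
rewrite (@sum_multiples k _ (fun i => a (i %/ k)%N * b (m - i %/ k)%N)) //.
rewrite mulnK // /fps_mul.
rewrite -(big_mkord xpredT (fun j => if (k * j < (m * k).+1)%N
  then a (k * j %/ k)%N * b (m - k * j %/ k)%N else 0)).
rewrite (big_cat_nat (n := m.+1)) ?ltnS ?leq_pmulr //= big_mkord.
rewrite [X in _ + X]big_nat [X in _ + X]big1 ?addr0 => [|j /andP[mj _]]; last first.
  by rewrite ltnS mulnC leq_pmul2r // leqNgt mj.
apply: eq_bigr => i _; rewrite ltnS [(m * k)%N]mulnC leq_pmul2l // -ltnS ltn_ord.
by rewrite mulKn.
Qed.

(** This is T(x^k) / k, where T = x (f(x^2) + f(x)^2) / 2 is the generating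
function of the trees whose two forests are counted by [f]. *)
Definition pair_series (f : fps) (k : nat) : fps :=
  fps_scale ((2 * k)%N%:R)^-1
    (fps_mul (fps_monom k)
       (fps_add (fps_subst (2 * k) f) (fps_pow (fps_subst k f) 2))).

(** In degree n, the logarithmic derivative of the right-hand side is the sum of
the m t(m) over the divisors m of n; with it, the equation of [fps_exp_unique] is
the recurrence [size_fo]. *)
Lemma functional_equation (fo : nat -> seq code) (f : fps) :
  (forall n, uniq (fo n)) ->
  (forall n x, (x \in fo n) = canon x && (csize x == n)) ->
  (forall n, f n = (size (fo n))%:R) ->
  f =1 fps_exp (fps_sum 1 (pair_series f)).
Proof.
move=> uniq_fo mem_fo fE; pose t m : rat := (size (tr fo m))%:R.
have trE m : 2 * t m.+1 = fps_add (fps_subst 2 f) (fps_mul f f) m.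
  rewrite -natrM size_tr // natrD natr_sum addrC; congr (_ + _).
    by rewrite /fps_subst; case: ifP; rewrite ?fE.
  by apply: eq_bigr => i _; rewrite natrM -!fE.
have pairE k n : (0 < k)%N -> (0 < n)%N ->
    pair_series f k n = if (k %| n)%N then t (n %/ k)%N / k%:R else 0.
  move=> k0 n0; rewrite /pair_series /fps_scale fps_mul_monom.
  case: leqP => kn; last by rewrite mulr0 gtnNdvd.
  rewrite /fps_add fps_pow2 fps_subst_mul // /fps_subst.
  have -> : (k %| n - k)%N = (k %| n)%N by rewrite dvdn_subl.
  have [/dvdnP[[|m] nE]|/negbTE kNn] := boolP (k %| n)%N; first by rewrite nE in n0.
    rewrite nE !(mulSn m) addKn -(mulSn m) !mulnK // dvdn_pmul2r //.
    rewrite divnMr // natrM invfM.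
    have := trE m; rewrite /fps_add /fps_subst => <-.
    by field; rewrite pnatr_eq0 -lt0n.
  rewrite (_ : (2 * k %| n - k)%N = false) ?addr0 ?mulr0 //.
  by apply: contraFF kNn => /(dvdn_trans (dvdn_mull _ (dvdnn k))); rewrite dvdn_subl.
set A := fps_sum _ _.
have thA n : fps_theta A n = \sum_(1 <= k < n.+1)
    (if (k %| n)%N then (n %/ k)%:R * t (n %/ k)%N else 0).
  rewrite /fps_theta mulr_sumr big_nat [RHS]big_nat; apply: eq_bigr => k /andP[k0].
  rewrite ltnS => kn; rewrite pairE // ?(leq_trans k0) //.
  case: ifP => [/dvdnP[m ->]|]; rewrite ?mulr0 // mulnK // natrM mulrA mulrAC.
  by field; rewrite pnatr_eq0 -lt0n.
apply: fps_exp_unique => [||n].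
- by rewrite /A /fps_sum big_geq.
- rewrite fE (_ : size _ = 1%N) //; apply/eqP; rewrite -[1%N]/(size [:: CNil]).
  apply/eqP/perm_size/uniq_perm => // x; rewrite mem_fo inE.
  by case: x => [//|a b y]; rewrite andbF; apply/esym/eqP.
transitivity (\sum_(1 <= j < n.+1) \sum_(1 <= m < n.+1)
  (if (j * m <= n)%N then m%:R * t m * f (n - j * m)%N else 0)).
  rewrite exchange_big /fps_theta fE -natrM (size_fo uniq_fo mem_fo) natr_sum.
  apply: eq_bigr => m _; rewrite natr_sum; apply: eq_bigr => j _.
  by case: ifP; rewrite // !natrM fE.
rewrite /fps_mul; under [RHS]eq_bigr => i _.
  rewrite thA mulr_suml.
  rewrite (_ : \sum_(1 <= k < i.+1) _ = \sum_(1 <= k < n.+1) (if (k %| i)%N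
      then (i %/ k)%:R * t (i %/ k)%N * f (n - i)%N else 0)); last first.
    rewrite [RHS](big_cat_nat (n := i.+1)) //= [X in _ + X]big_nat.
    rewrite [X in _ + X]big1 ?addr0 => [|k /andP[ik _]].
      by apply: eq_bigr => k _; case: ifP; rewrite ?mul0r.
    case: ifP => // /dvdnP[[|m] iE]; first by rewrite iE div0n !mul0r.
    by move: ik; rewrite iE ltnNge leq_pmull.
  over.
rewrite [RHS]exchange_big [LHS]big_nat [RHS]big_nat; apply: eq_bigr => k /andP[k0 _] /=.
rewrite (@sum_multiples k n.+1 (fun i => (i %/ k)%:R * t (i %/ k)%N * f (n - i)%N)) //.
rewrite -(big_mkord xpredT (fun j => if (k * j < n.+1)%N then
  (k * j %/ k)%:R * t (k * j %/ k)%N * f (n - k * j)%N else 0)) [RHS]big_ltn //.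
rewrite muln0 div0n !mul0r add0r; apply: eq_bigr => m _.
by rewrite ltnS mulKn.
Qed.

(** * Forests given by parent functions *)

(** The sign of a vertex is that of the edge to its parent, with [false] for
[+] and [true] for [-]. *)
Record pforest (V : finType) := PForest { par : V -> option V; sg : V -> bool }.

Section ParentForest.

Variables (V : finType) (P : pforest V).

Definition kids (b : bool) (v : V) : seq V :=
  [seq u <- enum V | (par P u == Some v) && (sg P u == b)].

Definition proots : seq V := [seq u <- enum V | par P u == None].

Lemma mem_kids b v u : (u \in kids b v) = (par P u == Some v) && (sg P u == b).
Proof. by rewrite mem_filter mem_enum andbT. Qed.

Lemma mem_proots u : (u \in proots) = (par P u == None).
Proof. by rewrite mem_filter mem_enum andbT. Qed.

Lemma uniq_kids b v : uniq (kids b v).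
Proof. exact/filter_uniq/enum_uniq. Qed.

Lemma uniq_proots : uniq proots.
Proof. exact/filter_uniq/enum_uniq. Qed.

(** The recursion goes down the tree, so it is bounded by a number of levels: this
is the code of the subtree at [v], truncated [k] levels below [v]. *)
Fixpoint vcode (k : nat) (v : V) : ctree :=
  if k is k'.+1 then
    tree_of (forest_code [seq vcode k' u | u <- kids false v])
            (forest_code [seq vcode k' u | u <- kids true v])
  else (CNil, CNil).

Definition pcode (k : nat) : code := forest_code [seq vcode k v | v <- proots].

Lemma canonT_vcode k v : canonT (vcode k v).
Proof.
elim: k v => [|k IHk] v; first exact: leqnn.
by apply: canon_tree_of; apply: canon_forest_code; apply/allP => _ /mapP[u _ ->].
Qed.

Lemma canon_pcode k : canon (pcode k).
Proof.
by apply: canon_forest_code; apply/allP => _ /mapP[u _ ->]; apply: canonT_vcode.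
Qed.

Definition depth (d : V -> nat) : Prop :=
  forall v, d v = if par P v is Some u then (d u).+1 else 0%N.

Section Depth.

Variable d : V -> nat.
Hypothesis depth_d : depth d.

Lemma depth_Some v u : par P v = Some u -> d v = (d u).+1.
Proof. by rewrite (depth_d v) => ->. Qed.

Lemma depth_eq0 v : (d v == 0%N) = (par P v == None).
Proof. by rewrite depth_d; case: (par P v). Qed.

Lemma depth_ind (R : V -> Prop) :
  (forall v, (forall u, par P v = Some u -> R u) -> R v) -> forall v, R v.
Proof.
move=> step v; have [m] := ubnP (d v); elim: m v => // m IHm v ltvm.
by apply: step => u /depth_Some vE; apply: IHm; rewrite -ltnS -vE.
Qed.

(** All numbers up to [d v] are depths, namely of the ancestors of [v]. *)
Lemma depth_lt v : (d v < #|V|)%N.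
Proof.
have below w : {subset iota 0 (d w).+1 <= [seq d u | u : V]}.
  elim/depth_ind: w => w IHw i; rewrite mem_iota leq0n ltnS leq_eqVlt /=.
  case/orP => [/eqP->|]; first exact: image_f.
  rewrite {1}depth_d; case E: (par P w) => [u|] //= iu.
  by apply: (IHw u E); rewrite mem_iota.
have := uniq_leq_size (iota_uniq _ _) (below v).
by rewrite size_iota size_image.
Qed.

(** The subtrees at the vertices of depth [j], truncated [k] levels below,
partition the vertices of depth between [j] and [j + k]. *)
Lemma tree_size_level k j : (\sum_(v | d v == j) tree_size (vcode k v) =
  #|[pred v | j <= d v <= j + k]|)%N.
Proof.
elim: k j => [|k IHk] j.
  rewrite sum1_card; apply: eq_card => v.
  by rewrite unfold_in inE addn0 [LHS]eqn_leq andbC.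
transitivity (\sum_(v | d v == j) 1 +
    \sum_(v | d v == j) \sum_(u | par P u == Some v) tree_size (vcode k u))%N.
  rewrite -big_split; apply: eq_bigr => v _ /=.
  rewrite tree_size_tree_of !csize_forest_code !big_map !big_filter add1n; congr _.+1.
  rewrite addnC [RHS](bigID (sg P)) /= !big_enum_cond /=.
  congr (_ + _)%N; apply: eq_bigl => u; first by case: (sg P u).
  by case: (sg P u); rewrite ?andbF.
rewrite sum1_card (exchange_big_dep (fun u => d u == j.+1)) /=; last first.
  by move=> v u /eqP <- /eqP/depth_Some ->.
rewrite (eq_bigr (fun u => tree_size (vcode k u))) => [|u /eqP du]; last first.
  move: (du); rewrite depth_d; case E: (par P u) => [w|] //= -[dw].
  by rewrite (big_pred1 w) // => v; apply/andP/eqP => [[_ /eqP[]] //|->]; rewrite dw.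
rewrite IHk addSnnS -cardUI [X in (_ + X)%N = _]eq_card0 ?addn0.
  by apply: eq_card => v; rewrite !inE !unfold_in /=; lia.
by move=> v; rewrite !inE !unfold_in /=; lia.
Qed.

Lemma csize_pcode k : (#|V| <= k)%N -> csize (pcode k) = #|V|.
Proof.
move=> Vk; rewrite csize_forest_code big_map big_filter big_enum_cond /=.
rewrite -(eq_bigl _ _ depth_eq0) tree_size_level; apply: eq_card => v.
by rewrite !inE /= (leq_trans (ltnW (depth_lt v))).
Qed.

End Depth.

End ParentForest.

(** The children of [f v] are the images of those of [v], with their signs kept or
all reversed; in the latter case the two forests below [v] are exchanged, which
[tree_of] does not see. *)
Lemma vcode_embed (V W : finType) (P : pforest V) (Q : pforest W)
    (f : V -> W) (e : V -> bool) :
  injective f ->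
  (forall v u, par P u = Some v ->
     par Q (f u) = Some (f v) /\ sg Q (f u) = sg P u (+) e v) ->
  (forall v w, par Q w = Some (f v) -> exists2 u, w = f u & par P u = Some v) ->
  forall k v, vcode Q k (f v) = vcode P k v.
Proof.
move=> f_inj fP fQ; elim=> //= k IHk v.
have kidsE b : perm_eq (kids Q b (f v)) [seq f u | u <- kids P (b (+) e v) v].
  apply: uniq_perm; rewrite ?(map_inj_uniq f_inj) ?uniq_kids // => w.
  rewrite mem_kids; apply/andP/mapP => [[/eqP/fQ[u -> uv] /eqP <-]|[u]].
    by exists u; rewrite // mem_kids uv eqxx (fP _ _ uv).2 -addbA addbb addbF eqxx.
  rewrite mem_kids => /andP[/eqP uv /eqP sb] ->.
  by rewrite (fP _ _ uv).1 (fP _ _ uv).2 eqxx sb -addbA addbb addbF eqxx.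
have codeE b : forest_code [seq vcode Q k u | u <- kids Q b (f v)] =
    forest_code [seq vcode P k u | u <- kids P (b (+) e v) v].
  apply/forest_codeP; rewrite (permPl (perm_map _ (kidsE b))) -map_comp.
  by rewrite (eq_map (IHk : vcode Q k \o f =1 vcode P k)).
rewrite !codeE; case: (e v) => //=; exact: tree_ofC.
Qed.

Lemma pcode_embed (V W : finType) (P : pforest V) (Q : pforest W)
    (f : V -> W) (e : V -> bool) :
  bijective f ->
  (forall v, par Q (f v) = omap f (par P v)) ->
  (forall v u, par P u = Some v -> sg Q (f u) = sg P u (+) e v) ->
  forall k, pcode Q k = pcode P k.
Proof.
move=> f_bij parE sgE k; have f_inj := bij_inj f_bij; case: (f_bij) => g fK gK.
apply/forest_codeP; have rootsE : perm_eq (proots Q) [seq f u | u <- proots P].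
  apply: uniq_perm; rewrite ?(map_inj_uniq f_inj) ?uniq_proots // => w.
  rewrite -[w]gK (mem_map f_inj) !mem_proots parE.
  by case: (par P _).
rewrite (permPl (perm_map _ rootsE)) -map_comp.
suff E : vcode Q k \o f =1 vcode P k by rewrite (eq_map E).
move=> v; apply: (vcode_embed (e := e)) => // [{}v u uv|{}v w]; first by rewrite parE uv (sgE v).
rewrite -[w]gK parE; case E: (par P (g w)) => [u|] //= -[/f_inj uv].
by exists (g w); rewrite // E uv.
Qed.

(** * Equal codes give an isomorphism *)

(** When the two lists have the same values up to order, this is the bijection
that sends the [i]-th entry of the first list, sorted by values, to the [i]-th
entry of the second one. *)
Definition matching (V W : eqType) (T : countType) (c : V -> T) (c' : W -> T)
    (l : seq V) (l' : seq W) (w0 : W) (v : V) : W :=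
  nth w0 (sort (relpre c' (@ple _)) l') (index v (sort (relpre c (@ple _)) l)).

Section Matching.

Variables (V W : eqType) (T : countType) (c : V -> T) (c' : W -> T).
Variables (l : seq V) (l' : seq W).
Hypothesis eq_values : perm_eq (map c l) (map c' l').

Let size_eq : size (sort (relpre c (@ple _)) l) = size (sort (relpre c' (@ple _)) l').
Proof. by rewrite !size_sort -(size_map c) -(size_map c'); apply: perm_size. Qed.

Lemma matchingP w0 v : v \in l ->
  matching c c' l l' w0 v \in l' /\ c' (matching c c' l l' w0 v) = c v.
Proof.
rewrite -(mem_sort (relpre c (@ple _))) => vl; rewrite /matching.
have il : (index v (sort (relpre c (@ple _)) l) <
           size (sort (relpre c' (@ple _)) l'))%N by rewrite -size_eq index_mem.
split; first by rewrite -(mem_sort (relpre c' (@ple _))) mem_nth.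
rewrite -(nth_map _ (c v)) // -sort_map -(ple_sortP _ _ eq_values) sort_map.
by rewrite (nth_map v) ?index_mem // nth_index.
Qed.

Lemma matching_inj w0 w1 v v' : uniq l' -> v \in l -> v' \in l ->
  matching c c' l l' w0 v = matching c c' l l' w1 v' -> v = v'.
Proof.
rewrite -(sort_uniq (relpre c' (@ple _))) => ul'.
rewrite -!(mem_sort (relpre c (@ple _)) l) /matching => vl v'l.
rewrite (set_nth_default w0 w1) -?size_eq ?index_mem // => /eqP.
rewrite nth_uniq -?size_eq ?index_mem // => /eqP ii.
by rewrite -[v](nth_index v vl) ii nth_index.
Qed.

End Matching.

Section Completeness.

Variables (V : finType) (P Q : pforest V) (d : V -> nat) (k : nat).
Hypotheses (depth_d : depth P d) (le_k : (#|V| <= k)%N).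
Hypothesis eq_code : pcode P k = pcode Q k.

(** Vertices [u] and [w] with equal codes have the same two forests below them, up
to order; the children of [u] have to be matched with children of the opposite
sign when the forests come in the other order. *)
Definition reversed m (u w : V) : bool :=
  forest_code [seq vcode P m v | v <- kids P false u] !=
  forest_code [seq vcode Q m v | v <- kids Q false w].

Lemma perm_kids m u w b : vcode P m.+1 u = vcode Q m.+1 w ->
  perm_eq [seq vcode P m v | v <- kids P b u]
          [seq vcode Q m v | v <- kids Q (b (+) reversed m u w) w].
Proof.
move=> uw; apply/forest_codeP; move: uw; rewrite /= /reversed.
by case: eqP => [E|nE] /tree_of_inj[[E1 E2]|[E1 E2]] //=; case: b => //=;
  rewrite ?E1 ?E2 // -?E ?E1 // -?E2.
Qed.

(** The isomorphism is built from the roots down: the children of a vertex are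
matched with the children of its image, among equal codes. Codes truncated at
level [k] of the forest are compared, so those of vertices of depth [i] are
truncated [k - i] levels below. *)
Definition match_root (v : V) : V :=
  matching (vcode P k) (vcode Q k) (proots P) (proots Q) v v.

Definition match_kid (m : nat) (u w v : V) : V :=
  matching (vcode P m) (vcode Q m)
    (kids P (sg P v) u) (kids Q (sg P v (+) reversed m u w) w) v v.

Fixpoint match_upto (i : nat) (v : V) : V :=
  match i, par P v with
  | i'.+1, Some u => match_kid (k - d v) u (match_upto i' u) v
  | _, _ => match_root v
  end.

Definition match_vertex (v : V) : V := match_upto (d v) v.

Definition match_rev (u : V) : bool := reversed (k - (d u).+1) u (match_vertex u).

Lemma match_vertexE v : match_vertex v =
  if par P v is Some u then match_kid (k - d v) u (match_vertex u) v
  else match_root v.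
Proof.
rewrite /match_vertex; case E: (par P v) => [u|].
  by rewrite (depth_Some depth_d E) /= E (depth_Some depth_d E).
by case: (d v) => //= i; rewrite E.
Qed.

Lemma match_vertexP v :
  [/\ vcode Q (k - d v) (match_vertex v) = vcode P (k - d v) v,
      par Q (match_vertex v) = omap match_vertex (par P v) &
      forall u, par P v = Some u ->
        sg Q (match_vertex v) = sg P v (+) match_rev u].
Proof.
elim/(depth_ind depth_d): v => v IHv; rewrite match_vertexE.
case E: (par P v) => [u|] /=.
  have [uE _ _] := IHv u E; have vE := depth_Some depth_d E.
  have kE : (k - d u = (k - d v).+1)%N.
    by rewrite vE subnSK // (leq_trans (depth_lt depth_d u)).
  rewrite kE in uE; have pk := perm_kids (sg P v) (esym uE).
  have vk : v \in kids P (sg P v) u by rewrite mem_kids E !eqxx.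
  have [] := matchingP pk v vk; rewrite -/(match_kid _ _ _ _) mem_kids.
  move=> /andP[/eqP-> /eqP->] ->; split=> // _ [<-].
  by rewrite /match_rev -vE.
have vr : v \in proots P by rewrite mem_proots E.
have [] := matchingP (introT (forest_codeP _ _) eq_code) v vr.
rewrite -/(match_root _) mem_proots => /eqP -> vE; split=> //.
by rewrite depth_d E subn0.
Qed.

Lemma match_vertex_inj : injective match_vertex.
Proof.
move=> v; elim/(depth_ind depth_d): v => v IHv v' vv'.
have [_ vpar vsg] := match_vertexP v; have [_ vpar' vsg'] := match_vertexP v'.
move: vpar vpar' vsg vsg'; rewrite -vv' => -> /=.
case E: (par P v) => [u|]; case E': (par P v') => [u'|] //=; last first.
  move=> _ _ _; move: vv'; rewrite !match_vertexE E E' => /matching_inj; apply.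
  - by apply/forest_codeP.
  - exact: uniq_proots.
  - by rewrite mem_proots E.
  - by rewrite mem_proots E'.
move=> [/(IHv u E) uu']; subst u' => /(_ u erefl) -> /(_ u erefl) /addIb sE.
have dE : d v = d v' by rewrite (depth_Some depth_d E) (depth_Some depth_d E').
have [uE _ _] := match_vertexP u.
have kE : (k - d u = (k - d v).+1)%N.
  rewrite (depth_Some depth_d E) subnSK //.
  exact: leq_trans (depth_lt depth_d u) le_k.
rewrite kE in uE; move: vv'; rewrite !match_vertexE E E' /match_kid -dE -sE.
move=> /matching_inj; apply.
- exact: perm_kids.
- exact: uniq_kids.
- by rewrite mem_kids E !eqxx.
- by rewrite mem_kids E' sE !eqxx.
Qed.

Lemma pcode_complete : exists (f : {perm V}) (e : V -> bool),
  (forall v, par Q (f v) = omap f (par P v)) /\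
  (forall v u, par P v = Some u -> sg Q (f v) = sg P v (+) e u).
Proof.
exists (perm match_vertex_inj), match_rev; split=> [v|v u E].
  have [_] := match_vertexP v; rewrite permE => -> _.
  by case: (par P v) => //= u; rewrite permE.
by rewrite permE; case: (match_vertexP v) => _ _; apply.
Qed.

End Completeness.

(** * Every canonical code is attained *)

Section Join.

Variables (A B Y : finType) (PA : pforest A) (PB : pforest B) (PY : pforest Y).

Let V : finType := option (A + B + Y)%type.
Let inA (x : A) : V := Some (inl (inl x)).
Let inB (x : B) : V := Some (inl (inr x)).
Let inY (y : Y) : V := Some (inr y).

Let inA_inj : injective inA. Proof. by move=> ? ? []. Qed.
Let inB_inj : injective inB. Proof. by move=> ? ? []. Qed.
Let inY_inj : injective inY. Proof. by move=> ? ? []. Qed.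

(** A forest for the code [CCons a b y] from forests for [a], [b] and [y]: the
vertex [None] is the root of the first tree. *)
Definition join : pforest V :=
  {| par v := match v with
              | None => None
              | Some (inl (inl x)) => Some (oapp inA None (par PA x))
              | Some (inl (inr x)) => Some (oapp inB None (par PB x))
              | Some (inr y) => omap inY (par PY y)
              end;
     sg v := match v with
             | None => false
             | Some (inl (inl x)) => if par PA x is Some _ then sg PA x else false
             | Some (inl (inr x)) => if par PB x is Some _ then sg PB x else true
             | Some (inr y) => sg PY y
             end |}.

Lemma depth_join dA dB dY :
  depth PA dA -> depth PB dB -> depth PY dY -> exists d, depth join d.
Proof.
move=> hA hB hY; exists (fun v => match v with
  | None => 0%N
  | Some (inl (inl x)) => (dA x).+1
  | Some (inl (inr x)) => (dB x).+1
  | Some (inr y) => dY y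
  end) => -[[[x|x]|y]|] //=.
- by rewrite hA; case: (par PA x).
- by rewrite hB; case: (par PB x).
- by rewrite hY; case: (par PY y).
Qed.

Lemma vcode_inA k x : vcode join k (inA x) = vcode PA k x.
Proof.
apply: (vcode_embed (e := fun=> false)) => [? ? [] //|v u uv|v [[[w|w]|w]|] //=].
- by rewrite /= uv addbF.
- by case E: (par PA w) => [u|] //= [<-]; exists w.
- by case: (par PB w).
- by case: (par PY w).
Qed.

Lemma vcode_inB k x : vcode join k (inB x) = vcode PB k x.
Proof.
apply: (vcode_embed (e := fun=> false)) => [? ? [] //|v u uv|v [[[w|w]|w]|] //=].
- by rewrite /= uv addbF.
- by case: (par PA w).
- by case E: (par PB w) => [u|] //= [<-]; exists w.
- by case: (par PY w).
Qed.

Lemma vcode_inY k y : vcode join k (inY y) = vcode PY k y.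
Proof.
apply: (vcode_embed (e := fun=> false)) => [? ? [] //|v u uv|v [[[w|w]|w]|] //=].
- by rewrite /= uv addbF.
- by case: (par PA w).
- by case: (par PB w).
- by case E: (par PY w) => [u|] //= [<-]; exists w.
Qed.

Lemma vcode_None k :
  vcode join k.+1 None = tree_of (pcode PA k) (pcode PB k).
Proof.
have kidsA : perm_eq (kids join false None) [seq inA x | x <- proots PA].
  apply: uniq_perm; rewrite ?uniq_kids ?(map_inj_uniq inA_inj) ?uniq_proots // => v.
  rewrite mem_kids; apply/andP/mapP => [|[x]].
    case: v => [[[x|x]|y]|] /= [] //.
    - by case E: (par PA x) => //= _ _; exists x; rewrite // mem_proots E.
    - by case: (par PB x).
    by case: (par PY y).
  by rewrite mem_proots => /eqP E ->; rewrite /= E.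
have kidsB : perm_eq (kids join true None) [seq inB x | x <- proots PB].
  apply: uniq_perm; rewrite ?uniq_kids ?(map_inj_uniq inB_inj) ?uniq_proots // => v.
  rewrite mem_kids; apply/andP/mapP => [|[x]].
    case: v => [[[x|x]|y]|] /= [] //.
    - by case: (par PA x).
    - by case E: (par PB x) => //= _ _; exists x; rewrite // mem_proots E.
    by case: (par PY y).
  by rewrite mem_proots => /eqP E ->; rewrite /= E.
rewrite /=; congr tree_of; apply/forest_codeP.
  rewrite (permPl (perm_map _ kidsA)) -map_comp.
  by rewrite (eq_map (vcode_inA k : vcode join k \o inA =1 vcode PA k)).
rewrite (permPl (perm_map _ kidsB)) -map_comp.
by rewrite (eq_map (vcode_inB k : vcode join k \o inB =1 vcode PB k)).
Qed.

Lemma pcode_join k : pcode join k.+1 =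
  forest_code (tree_of (pcode PA k) (pcode PB k) :: trees (pcode PY k.+1)).
Proof.
have rootsE : perm_eq (proots join) (None :: [seq inY y | y <- proots PY]).
  apply: uniq_perm; rewrite ?uniq_proots //=.
    by rewrite (map_inj_uniq inY_inj) uniq_proots andbT; apply/mapP => -[].
  move=> v; rewrite mem_proots inE; case: v => [[[x|x]|y]|] //=.
  - by apply/esym/mapP => -[].
  - by apply/esym/mapP => -[].
  by rewrite (mem_map inY_inj) mem_proots; case: (par PY y).
apply/forest_codeP; rewrite (permPl (perm_map _ rootsE)) map_cons vcode_None perm_cons.
rewrite -map_comp (eq_map (vcode_inY k.+1 : vcode join k.+1 \o inY =1 vcode PY k.+1)).
by rewrite perm_sym perm_trees_forest_code.
Qed.

End Join.

Lemma canon_attained x : canon x -> exists (V : finType) (P : pforest V),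
  [/\ #|V| = csize x, exists d, depth P d &
      forall k, (csize x <= k)%N -> pcode P k = x].
Proof.
elim: x => [_|a IHa b IHb y IHy cx].
  pose P := @PForest void (fun=> None) (fun=> false).
  exists void, P; split=> [||k _]; first exact: card_void.
    by exists (fun=> 0%N) => -[].
  apply: canon_perm_inj; rewrite ?canon_pcode //.
  rewrite (permPl (perm_trees_forest_code _)) (_ : proots P = [::]) //.
  by rewrite /proots; case: (enum _) => // -[].
have := cx => /= /and5P[/IHa[A [PA [cardA [dA hA] codeA]]]].
move=> /IHb[B [PB [cardB [dB hB] codeB]]] ab /IHy[Y [PY [cardY [dY hY] codeY]]] _.
exists _, (join PA PB PY); split=> [||k].
- by rewrite card_option !card_sum cardA cardB cardY.
- exact: depth_join hA hB hY.
case: k => // k; rewrite /= ltnS => le_k; rewrite pcode_join.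
rewrite codeA ?codeB ?codeY ?tree_of_id //; try lia.
exact: (forest_code_id cx).
Qed.

Lemma canon_attained_ord x : canon x -> exists (P : pforest 'I_(csize x)),
  (exists d, depth P d) /\ pcode P (csize x) = x.
Proof.
move=> cx; have [V [P [cardV [d hd] codeP]]] := canon_attained cx.
move: (codeP _ (leqnn _)) => {codeP}.
move: (csize x) cardV => n cardV; subst n => <-.
pose Q := {| par v := omap (@enum_rank V) (par P (enum_val v));
             sg v := sg P (enum_val v) |}.
exists Q; split.
  exists (d \o enum_val) => v /=; rewrite hd.
  by case: (par P _) => //= u; rewrite enum_rankK.
apply: (pcode_embed (f := @enum_rank V) (e := fun=> false)) => [|v|v u uv].
- exact: enum_rank_bij.
- by rewrite /= enum_rankK.
by rewrite /= enum_rankK addbF.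
Qed.

(** * Graphs of parent functions *)

Section GraphOf.

Variables (n : nat) (P : pforest 'I_n).

Definition edge_up (v : 'I_n) : {set 'I_n} :=
  if par P v is Some u then [set v; u] else set0.

Definition nonroots : {set 'I_n} := [set v | par P v != None].

Definition graph_of : srgraph n := SRGraph
  [set edge_up v | v in nonroots]
  [set v | par P v == None]
  [set edge_up v | v in [set v in nonroots | sg P v]].

Hypothesis has_depth : exists d, depth P d.

Lemma par_asym u v : par P v = Some u -> par P u <> Some v.
Proof.
by case: has_depth => d hd /(depth_Some hd) vu /(depth_Some hd) uv; lia.
Qed.

Lemma par_neq u v : par P v = Some u -> v != u.
Proof. by move=> vu; apply/eqP => E; subst u; case: (par_asym vu vu). Qed.

(** An edge with two lower ends would make each of its ends the parent of the
other. *)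
Lemma edge_up_inj : {in nonroots &, injective edge_up}.
Proof.
move=> v w; rewrite !inE /edge_up.
case vE: (par P v) => [u|] //; case wE: (par P w) => [t|] // _ _ /setP E.
have := E v; rewrite !inE eqxx /= => /esym/orP[/eqP //|/eqP vt].
have := E w; rewrite !inE eqxx /= => /orP[/eqP //|/eqP wu].
by case: (par_asym vE); rewrite -wu wE vt.
Qed.

Lemma mem_edge_up (A : {set 'I_n}) v : A \subset nonroots -> v \in nonroots ->
  (edge_up v \in [set edge_up w | w in A]) = (v \in A).
Proof.
move=> /subsetP sA vP; apply/imsetP/idP => [[w wA /edge_up_inj ->]|vA] //.
  exact: sA.
by exists v.
Qed.

Lemma adj_graph_of u v :
  adj graph_of u v = (par P u == Some v) || (par P v == Some u).
Proof.
apply/imsetP/orP => [[w]|[/eqP E|/eqP E]]; last 2 first.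
- by exists u; rewrite ?inE /edge_up E.
- by exists v; rewrite ?inE /edge_up E // setUC.
rewrite inE /edge_up; case wE: (par P w) => [t|] // _ /setP E.
have wt := par_neq wE; have := E t; have := E w; have := E v; have := E u.
rewrite !inE !eqxx !orbT /= => /esym/orP[/eqP->|/eqP->] /esym/orP[/eqP->|/eqP->].
- by rewrite orbb [t == w]eq_sym (negPf wt).
- by move=> _ _; left; rewrite wE.
- by move=> _ _; right; rewrite wE.
by rewrite orbb (negPf wt).
Qed.

(** In a cycle with more than two vertices, both neighbours of a deepest vertex
would be its parent. *)
Lemma acyclic_graph_of : acyclic graph_of.
Proof.
have [d hd] := has_depth; apply/forallP => -[c /= _]; apply/implyP => /andP[cyc uc].
rewrite leqNgt; apply/negP => c3.
have [x0 x0c] : exists x, x \in c by case: (c) c3 => // x ? _; exists x; rewrite mem_head.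
case: (arg_maxnP d x0c) => x xc xmax.
have up y : y \in c -> adj graph_of x y -> par P x = Some y.
  move=> yc; rewrite adj_graph_of => /orP[/eqP //|/eqP/(depth_Some hd) yx].
  by have := xmax y yc; rewrite yx /= ltnn.
have [i p pE] := rot_to xc.
have pc : {subset p <= c} by move=> y yp; rewrite -(mem_rot i) pE inE yp orbT.
move: cyc uc c3; rewrite -(rot_cycle i) -(rot_uniq i) -(size_rot i c) pE.
case: p pE pc => [//|y p] pE pc; case/lastP: p pE pc => [//|p z] pE pc.
rewrite /= !rcons_path last_rcons => /and3P[xy _ zx].
case/and3P=> _; rewrite mem_rcons inE negb_or => /andP[yz _] _ _.
have xz : adj graph_of x z by rewrite /adj setUC.
have := up z; rewrite (up y) ?pc ?inE ?mem_rcons ?inE ?eqxx ?orbT //.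
by move=> /(_ isT xz) [] yzE; rewrite yzE eqxx in yz.
Qed.

Lemma connect_graph_of_root v :
  exists2 r, par P r = None & connect (adj graph_of) v r.
Proof.
have [d hd] := has_depth; elim/(depth_ind hd): v => v IHv.
case E: (par P v) => [u|]; last by exists v.
have [r rP ur] := IHv u E; exists r => //; apply: connect_trans ur.
by apply: connect1; rewrite adj_graph_of E eqxx.
Qed.

(** The root that is reached from a vertex through its ancestors is the same at
both ends of an edge. *)
Lemma connect_graph_of_uniq r r' : par P r = None -> par P r' = None ->
  connect (adj graph_of) r r' -> r = r'.
Proof.
have [d hd] := has_depth; pose anc v := odflt v (par P v).
pose rt v := iter (d v) anc v.
have rtE v u : par P v = Some u -> rt v = rt u.
  by move=> E; rewrite /rt (depth_Some hd E) iterSr /anc E.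
have rt_root v : par P v = None -> rt v = v.
  by move=> E; rewrite /rt (hd v) E.
move=> rP r'P /connectP[p rp r'E]; rewrite -[LHS]rt_root // -[RHS]rt_root //.
rewrite {}r'E {rP r'P}; elim: p r rp => //= v p IHp r /andP[rv /IHp <-].
by move: rv; rewrite adj_graph_of => /orP[/eqP/rtE|/eqP/rtE].
Qed.

Lemma srforest_graph_of : graph_of \in srforests n.
Proof.
rewrite inE; apply/and4P; split; last 1 first.
- apply/forallP => v; have [r rP vr] := connect_graph_of_root v.
  apply/cards1P; exists r; apply/setP => t; rewrite !inE.
  apply/andP/eqP => [[/eqP tP vt]|->]; last by rewrite rP.
  apply: connect_graph_of_uniq => //; apply: connect_trans vr.
  have sym : connect_sym (adj graph_of).
    by apply: sym_connect_sym => x y; rewrite /adj setUC.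
  by rewrite sym.
- apply/forallP => e; apply/implyP => /imsetP[v]; rewrite inE /edge_up.
  by case E: (par P v) => [u|] // _ ->; rewrite cards2 par_neq.
- by apply: imsetS; apply/subsetP => v; rewrite inE => /andP[].
- exact: acyclic_graph_of.
Qed.

End GraphOf.

(** A graph of a parent function determines it: if [u] is the parent of [v] for
[P] but not for [Q] then, the edge being the same, [v] is the parent of [u] for
[Q]; by induction from the roots down it is so for [P] too. *)
Lemma graph_of_inj n (P Q : pforest 'I_n) :
  (exists d, depth P d) -> (exists d, depth Q d) ->
  graph_of P = graph_of Q ->
  par P =1 par Q /\ forall v u, par P v = Some u -> sg P v = sg Q v.
Proof.
move=> hP hQ PQ; have [d hd] := hP.
have parE : par P =1 par Q.
  elim/(depth_ind hd) => v IHv; case E: (par P v) => [u|].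
    have : adj (graph_of Q) v u by rewrite -PQ adj_graph_of // E eqxx.
    rewrite adj_graph_of // => /orP[/eqP //|]; rewrite -(IHv u E) => /eqP.
    by move/(par_asym hP E).
  have : v \in Defs.roots (graph_of P) by rewrite inE E.
  by rewrite PQ inE => /eqP.
split=> // v u E; have eupE : edge_up P =1 edge_up Q by move=> w; rewrite /edge_up parE.
have vP : v \in nonroots P by rewrite inE E.
have vQ : v \in nonroots Q by rewrite inE -parE E.
have subP (R : pforest 'I_n) : [set w in nonroots R | sg R w] \subset nonroots R.
  by apply/subsetP => w; rewrite inE => /andP[].
have := congr1 (fun g => edge_up P v \in negs g) PQ.
by rewrite /= mem_edge_up // eupE mem_edge_up // !inE -parE E.
Qed.

(** * The parent function of a forest *)

Section Orient.

Variables (n : nat) (g : srgraph n).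
Hypothesis forest_g : g \in srforests n.

Let e := adj g.

Lemma adj_sym : symmetric e.
Proof. by move=> x y; rewrite /e /adj setUC. Qed.

Let csym : connect_sym e := sym_connect_sym adj_sym.

Lemma adj_neq x y : e x y -> x != y.
Proof.
move=> xy; move: forest_g; rewrite inE => /and4P[/forallP/(_ [set x; y])].
by move=> /implyP/(_ xy) c2 _ _ _; move: c2; rewrite cards2; case: (x != y).
Qed.

Lemma walkP k x y :
  reflect (exists p, [/\ size p = k, path e x p & last x p = y]) (walk g k x y).
Proof.
apply: (iffP existsP) => [[p /andP[xp /eqP lp]]|[p [<- xp lp]]].
  by exists p; rewrite size_tuple.
by exists (in_tuple p); rewrite xp lp eqxx.
Qed.

Lemma walk_dist x y : connect e x y -> walk g (dist g x y) x y.
Proof.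
move=> /connectP[p xp yE]; case/shortenP: xp yE => q xq uq _ yE.
have qn : (size q < n)%N by have := max_card (mem (x :: q)); rewrite (card_uniqP uq) card_ord.
have : has (fun k => walk g k x y) (iota 0 n).
  apply/hasP; exists (size q); first by rewrite mem_iota.
  by apply/walkP; exists q.
move=> hq; have := nth_find 0%N hq; rewrite nth_iota //.
by move: hq; rewrite has_find size_iota.
Qed.

Lemma dist_le x y k : walk g k x y -> (dist g x y <= k)%N.
Proof.
move=> xy; rewrite leqNgt; apply/negP => lt_k; have := before_find 0%N lt_k.
rewrite nth_iota ?xy //; apply: leq_trans lt_k _.
by rewrite -[X in (_ <= X)%N](size_iota 0) find_size.
Qed.

Lemma dist_xx x : dist g x x = 0%N.
Proof. by apply/eqP; rewrite -leqn0; apply/dist_le/walkP; exists [::]. Qed.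

Lemma dist_adj x y z : connect e x y -> e y z -> (dist g x z <= (dist g x y).+1)%N.
Proof.
move=> /walk_dist/walkP[p [<- xp yE]] yz; apply/dist_le/walkP; exists (rcons p z).
by rewrite size_rcons rcons_path xp yE yz last_rcons.
Qed.

Lemma dist_pred x z : connect e x z -> x != z ->
  exists y, [/\ connect e x y, e y z & dist g x z = (dist g x y).+1].
Proof.
move=> /walk_dist/walkP[p []]; case/lastP: p => [|p t].
  by move=> _ _ /= -> /eqP.
rewrite size_rcons rcons_path last_rcons => pE /andP[xp yt] tE _.
rewrite {}tE in yt; have xy : connect e x (last x p) by apply/connectP; exists p.
exists (last x p); split=> //; apply/eqP; rewrite eqn_leq dist_adj //= -pE ltnS.
by apply/dist_le/walkP; exists p.
Qed.

(** If [u] and [u'] were different, the shortest paths from [x] to them would not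
meet [v], so that there would be a cycle through [v]. *)
Lemma closer_uniq x v u u' : connect e x v -> e v u -> e v u' ->
  (dist g x u <= dist g x v)%N -> (dist g x u' <= dist g x v)%N -> u = u'.
Proof.
move=> xv vu vu' du du'; apply/eqP; apply: contraT => neq_u.
pose e' : rel 'I_n := fun a b => [&& e a b, a != v & b != v].
have avoid w : connect e x w -> w != v -> (dist g x w <= dist g x v)%N ->
    connect e' x w.
  have [m] := ubnP (dist g x w); elim: m w => // m IHm w ltw xw wv dw.
  have [->|xNw] := eqVneq x w; first exact: connect0.
  have [y [xy yw wE]] := dist_pred xw xNw.
  have yv : y != v by apply: contraTneq dw => <-; rewrite wE ltnn.
  have yw' : e' y w by rewrite /e' yw yv wv.
  apply: connect_trans (connect1 yw').
  apply: IHm => //; first by rewrite -wE.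
  by apply: leq_trans dw; rewrite wE.
have xu : connect e x u := connect_trans xv (connect1 vu).
have xu' : connect e x u' := connect_trans xv (connect1 vu').
have uv : u != v by rewrite eq_sym adj_neq.
have u'v : u' != v by rewrite eq_sym adj_neq.
have csym' : connect_sym e'.
  by apply: sym_connect_sym => a b; rewrite /e' adj_sym [X in _ && X]andbC.
have : connect e' u u'.
  by apply: (@connect_trans _ _ x); [rewrite csym' avoid | exact: avoid].
move=> /connectP[p up u'E]; case/shortenP: up u'E => q uq uniq_q _ u'E.
have vq : v \notin q.
  apply/negP => vq; case/splitPr: vq uq {u'E uniq_q} => q1 q2.
  by rewrite cat_path /= /e' eqxx /= !andbF.
have eq : path e u q by apply: sub_path uq => a b /and3P[].
have uniq_c : uniq [:: v, u & q] by rewrite cons_uniq inE negb_or eq_sym uv vq.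
have size_c : (size [:: v, u & q] <= n)%N.
  by have := max_card (mem [:: v, u & q]); rewrite (card_uniqP uniq_c) card_ord.
move: forest_g; rewrite inE => /and4P[_ _ /forallP/(_ (Bseq size_c))].
move=> /implyP/=; rewrite /ucycleb /= -/e rcons_path -u'E vu eq adj_sym vu' /=.
move: uniq_c; rewrite /= => -> /(_ isT); case: q u'E {uq uniq_q vq eq size_c} => //= u'E.
by rewrite u'E eqxx in neq_u.
Qed.

Lemma root_uniq v r r' : r \in Defs.roots g -> r' \in Defs.roots g ->
  connect e r v -> connect e r' v -> r = r'.
Proof.
move=> rg r'g rv r'v; move: forest_g; rewrite inE => /and4P[_ _ _].
move=> /forallP/(_ v)/cards1P[t tE].
have /set1P -> : r \in [set t] by rewrite -tE inE rg csym.
by have /set1P -> : r' \in [set t] by rewrite -tE inE r'g csym.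
Qed.

Lemma root_ex v : exists2 r, r \in Defs.roots g & connect e r v.
Proof.
move: forest_g; rewrite inE => /and4P[_ _ _ /forallP/(_ v)/cards1P[t tE]].
by have := set11 t; rewrite -tE inE csym => /andP[]; exists t.
Qed.

(** The root that occurs in the definition of [children] is the only root of the
component. *)
Lemma childP r v u : r \in Defs.roots g -> connect e r v ->
  (v \in children g u) = e u v && (dist g r u < dist g r v)%N.
Proof.
move=> rg rv; rewrite inE -/e; apply: andb_id2l => uv.
have ru : connect e r u by rewrite (connect_trans rv) // connect1 // adj_sym.
apply/existsP/idP => [[r' /and3P[r'g r'u]]|lt_uv]; last by exists r; rewrite rg ru.
by rewrite (root_uniq rg r'g ru r'u).
Qed.

Definition orient : pforest 'I_n :=
  {| par v := [pick u | v \in children g u];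
     sg v := if [pick u | v \in children g u] is Some u
             then [set v; u] \in negs g else false |}.

Lemma par_orient u v : (par orient v == Some u) = (v \in children g u).
Proof.
have [r rg rv] := root_ex v.
rewrite /=; case: pickP => [w vw|noc]; last by rewrite noc.
apply/eqP/idP => [[<-] //|vu]; congr Some.
move: vw vu; rewrite !(childP _ rg rv) => /andP[wv dw] /andP[uv du].
by apply: (closer_uniq rv); rewrite 1?adj_sym // ltnW.
Qed.

Lemma par_orient_root v : (par orient v == None) = (v \in Defs.roots g).
Proof.
have [r rg rv] := root_ex v; apply/eqP/idP => [vN|vg].
  have [<- //|rNv] := eqVneq r v; have [y [ry yv vE]] := dist_pred rv rNv.
  suff /eqP : par orient v == Some y by rewrite vN.
  by rewrite par_orient (childP _ rg rv) yv vE /=.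
case E: (par orient v) => [u|] //; move/eqP: E.
by rewrite par_orient (childP _ vg) // dist_xx andbF.
Qed.

Lemma depth_orient : exists d, depth orient d.
Proof.
pose rt v := if [pick r in Defs.roots g | connect e r v] is Some r then r else v.
have rtP v : rt v \in Defs.roots g /\ connect e (rt v) v.
  rewrite /rt; case: pickP => [r /andP[] //|noc]; have [r rg rv] := root_ex v.
  by have := noc r; rewrite rg rv.
exists (fun v => dist g (rt v) v) => v; have [rg rv] := rtP v.
case E: (par orient v) => [u|]; last first.
  have vg : v \in Defs.roots g by rewrite -par_orient_root E.
  by rewrite (root_uniq rg vg rv) // dist_xx.
move/eqP: E; rewrite par_orient (childP _ rg rv) => /andP[uv lt_uv].
have ru : connect e (rt v) u by rewrite (connect_trans rv) // connect1 // adj_sym.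
have [r'g r'u] := rtP u; rewrite (root_uniq r'g rg r'u ru).
by apply/eqP; rewrite eqn_leq lt_uv dist_adj.
Qed.

(** If both ends of an edge were at the same distance from the root, then one end
would be, besides the predecessor on a shortest path, a second neighbour of the
other end that is not farther from the root. *)
Lemma edges_orient x y : e x y ->
  (par orient x == Some y) || (par orient y == Some x).
Proof.
move=> xy; have [r rg rx] := root_ex x.
have ry : connect e r y := connect_trans rx (connect1 xy).
rewrite !par_orient (childP _ rg rx) (childP _ rg ry) xy [e y x]adj_sym xy /=.
case: ltngtP => // dE; have [ryE|rNy] := eqVneq r y.
  have [rxE|rNx] := eqVneq r x; first by have := adj_neq xy; rewrite -rxE -ryE eqxx.
  have [z [_ _]] := dist_pred rx rNx; by rewrite -dE -ryE dist_xx.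
have [z [rz zy yE]] := dist_pred ry rNy.
have xz : x = z.
  by apply: (closer_uniq ry); rewrite 1?adj_sym // -?dE // yE.
by move: yE; rewrite -xz -dE => /n_Sn.
Qed.

Lemma graph_of_orient : graph_of orient = g.
Proof.
have edgesE x : x \in edges g -> exists2 v, v \in nonroots orient & x = edge_up orient v.
  move=> xg; move: forest_g; rewrite inE => /and4P[/forallP/(_ x)/implyP/(_ xg)].
  move=> /cards2P[a [b [_ xE]]] _ _ _; have ab : e a b by rewrite /e /adj -xE.
  case/orP: (edges_orient ab) => /eqP E; [exists a | exists b];
    by rewrite ?inE /edge_up E // setUC.
have negsE v : v \in nonroots orient -> sg orient v = (edge_up orient v \in negs g).
  by rewrite inE /edge_up /=; case: pickP.
have sub : negs g \subset edges g by move: forest_g; rewrite inE => /and4P[].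
transitivity (SRGraph (edges g) (Defs.roots g) (negs g)); last by case: (g).
congr SRGraph.
- apply/setP => x.
  apply/imsetP/idP => [[v]|/edgesE //]; rewrite inE /edge_up.
  case vE: (par orient v) => [u|] // _ ->; move/eqP: vE.
  by rewrite par_orient inE => /andP[+ _]; rewrite /adj setUC.
- by apply/setP => v; rewrite inE par_orient_root.
apply/setP => x; apply/imsetP/idP => [[v]|xN].
  by rewrite inE => /andP[vn]; rewrite negsE // => vN ->.
have [v vn xE] := edgesE x (subsetP sub x xN); exists v => //.
by rewrite inE vn negsE -?xE.
Qed.

End Orient.

(** * Reversals and isomorphisms of graphs of parent functions *)

Definition gcode n (g : srgraph n) : code := pcode (orient g) n.

Section GraphCode.

Variables (n : nat) (P : pforest 'I_n).
Hypothesis has_depth : exists d, depth P d.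

Let g := graph_of P.

Let forest_g : g \in srforests n := srforest_graph_of has_depth.

Lemma orient_graph_of : par P =1 par (orient g) /\
  forall v u, par P v = Some u -> sg P v = sg (orient g) v.
Proof.
apply: graph_of_inj => //; first exact: depth_orient.
by rewrite graph_of_orient.
Qed.

Lemma gcode_graph_of : gcode g = pcode P n.
Proof.
have [parE sgE] := orient_graph_of.
apply: (pcode_embed (f := id) (e := fun=> false)) => [|v|v u uv].
- by exists id.
- by rewrite -parE; case: (par P v).
by rewrite -(sgE _ _ uv) addbF.
Qed.

Lemma children_graph_of i j : (j \in children g i) = (par P j == Some i).
Proof. by rewrite -par_orient // orient_graph_of.1. Qed.

Definition toggle (i : 'I_n) (R : pforest 'I_n) : pforest 'I_n :=
  {| par := par R; sg v := sg R v (+) (par R v == Some i) |}.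

Lemma flip_graph_of i : flip i g = graph_of (toggle i P).
Proof.
rewrite /flip /graph_of; congr SRGraph.
have -> : child_edges g i = [set edge_up P v | v in [set v | par P v == Some i]].
  apply/setP => x; apply/imsetP/imsetP => -[v].
    rewrite children_graph_of => /eqP E ->; exists v; first by rewrite inE E.
    by rewrite /edge_up E setUC.
  rewrite inE => /eqP E ->; exists v; first by rewrite children_graph_of E.
  by rewrite /edge_up E setUC.
have sub1 : [set v | par P v == Some i] \subset nonroots P.
  by apply/subsetP => v; rewrite !inE => /eqP ->.
have subs (R : pforest 'I_n) : [set w in nonroots R | sg R w] \subset nonroots R.
  by apply/subsetP => w; rewrite inE => /andP[].
have upE : edge_up (toggle i P) =1 edge_up P by [].
apply/setP => x; have [/imsetP[v vP ->]|xP] := boolP (x \in edges g).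
  rewrite -[in RHS]upE mem_edge_up ?subs // !inE !mem_edge_up ?subs // !inE /=.
  by move: vP; rewrite inE => ->; case: (sg P v); case: (_ == _).
have out (A : {set 'I_n}) : A \subset nonroots P ->
    (x \in [set edge_up P v | v in A]) = false.
  by move=> sA; apply: contraNF xP; apply/subsetP/imsetS.
rewrite !inE !out //=.
by apply/subsetP => w; rewrite inE => /andP[].
Qed.

Lemma pcode_toggle i k : pcode (toggle i P) k = pcode P k.
Proof.
apply: (pcode_embed (f := id) (e := pred1 i)) => [|v|v u /= ->].
- by exists id.
- by rewrite /=; case: (par P v).
by rewrite (inj_eq Some_inj).
Qed.

End GraphCode.

Section Transport.

Variables (n : nat) (f : {perm 'I_n}) (P Q : pforest 'I_n).
Hypothesis parE : forall v, par Q (f v) = omap f (par P v).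
Hypothesis sgE : forall v u, par P v = Some u -> sg Q (f v) = sg P v.

Lemma edge_up_transport v : f @: edge_up P v = edge_up Q (f v).
Proof.
rewrite /edge_up parE; case: (par P v) => [u|] /=; last exact: imset0.
by rewrite imsetU1 imset_set1.
Qed.

Lemma nonroots_transport v : (f v \in nonroots Q) = (v \in nonroots P).
Proof. by rewrite !inE parE; case: (par P v). Qed.

Lemma graph_transport :
  [/\ f @: Defs.roots (graph_of P) = Defs.roots (graph_of Q),
      [set f @: (x : {set 'I_n}) | x in edges (graph_of P)] = edges (graph_of Q) &
      [set f @: (x : {set 'I_n}) | x in negs (graph_of P)] = negs (graph_of Q)].
Proof.
have f_surj w : w = f ((f^-1)%g w) by rewrite permKV.
split; apply/setP => x.
- rewrite (f_surj x) mem_imset; last exact: perm_inj.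
  by rewrite !inE parE; case: (par P _).
- apply/imsetP/imsetP => [[_ /imsetP[v vP ->] ->]|[v]].
    by exists (f v); rewrite ?nonroots_transport ?edge_up_transport.
  rewrite (f_surj v); move: (_ v) => {}v; rewrite nonroots_transport => vP ->.
  exists (edge_up P v); last by rewrite edge_up_transport.
  exact: imset_f.
have negE v : (f v \in [set w in nonroots Q | sg Q w]) =
              (v \in [set w in nonroots P | sg P w]).
  rewrite !inE parE; case E: (par P v) => [u|] //=.
  by rewrite (sgE E).
apply/imsetP/imsetP => [[_ /imsetP[v vP ->] ->]|[v]].
  by exists (f v); rewrite ?negE ?edge_up_transport.
rewrite (f_surj v); move: (_ v) => {}v; rewrite negE => vP ->.
exists (edge_up P v); last by rewrite edge_up_transport.
exact: imset_f.
Qed.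

Lemma iso_graph_of : iso (graph_of P) (graph_of Q).
Proof.
by have [r e m] := graph_transport; apply/existsP; exists f; rewrite r e m !eqxx.
Qed.

End Transport.

(** * Codes classify the equivalence classes *)

Section Classes.

Variable n : nat.

Implicit Types g h : srgraph n.

Lemma srforestP g : reflect (exists P, (exists d, depth P d) /\ g = graph_of P)
  (g \in srforests n).
Proof.
apply: (iffP idP) => [fg|[P [hP ->]]]; last exact: srforest_graph_of.
by exists (orient g); split; [apply: depth_orient | rewrite graph_of_orient].
Qed.

Lemma imset_permM (s t : {perm 'I_n}) (A : {set 'I_n}) :
  (s * t)%g @: A = t @: (s @: A).
Proof. by rewrite -imset_comp; apply: eq_imset => v /=; rewrite permM. Qed.

Lemma imset2_permM (s t : {perm 'I_n}) (E : {set {set 'I_n}}) :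
  [set (s * t)%g @: (x : {set 'I_n}) | x in E] =
  [set t @: (x : {set 'I_n}) | x in [set s @: (x : {set 'I_n}) | x in E]].
Proof. by rewrite -imset_comp; apply: eq_imset => x /=; apply: imset_permM. Qed.

Lemma imset_perm1 (A : {set 'I_n}) : (1%g : {perm 'I_n}) @: A = A.
Proof. by rewrite -[RHS]imset_id; apply: eq_imset => v; apply: perm1. Qed.

Lemma imset2_perm1 (E : {set {set 'I_n}}) :
  [set (1%g : {perm 'I_n}) @: (x : {set 'I_n}) | x in E] = E.
Proof. by rewrite -[RHS]imset_id; apply: eq_imset => x; apply: imset_perm1. Qed.

Lemma iso_refl g : iso g g.
Proof.
by apply/existsP; exists 1%g; rewrite imset_perm1 !imset2_perm1 !eqxx.
Qed.

Lemma iso_trans g h k : iso g h -> iso h k -> iso g k.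
Proof.
move=> /existsP[s /and3P[/eqP sr /eqP se /eqP sn]].
move=> /existsP[t /and3P[/eqP tr /eqP te /eqP tn]].
apply/existsP; exists (s * t)%g; rewrite imset_permM !imset2_permM.
by rewrite sr se sn tr te tn !eqxx.
Qed.

Lemma iso_sym g h : iso g h -> iso h g.
Proof.
move=> /existsP[s /and3P[/eqP rE /eqP eE /eqP nE]]; apply/existsP; exists s^-1%g.
rewrite -{}rE -{}eE -{}nE.
by rewrite -imset_permM -!imset2_permM mulgV imset_perm1 !imset2_perm1 !eqxx.
Qed.

(** A graph isomorphic to that of a parent function is the graph of the conjugate
parent function. *)
Lemma gcode_iso g h : g \in srforests n -> iso g h ->
  gcode h = gcode g /\ h \in srforests n.
Proof.
move=> /srforestP[P [[d hd] ->]] /existsP[s /and3P[/eqP rE /eqP eE /eqP nE]].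
pose Q := {| par v := omap s (par P (s^-1%g v)); sg v := sg P (s^-1%g v) |}.
have parE v : par Q (s v) = omap s (par P v) by rewrite /= permK.
have sgE v u : par P v = Some u -> sg Q (s v) = sg P v by rewrite /= permK.
have -> : h = graph_of Q.
  have [rE' eE' nE'] := graph_transport parE sgE.
  rewrite rE in rE'; rewrite eE in eE'; rewrite nE in nE'.
  by case: h rE' eE' nE' {rE eE nE} => E R N /= -> -> ->.
have hQ : exists d, depth Q d.
  exists (d \o (s^-1)%g) => v /=; rewrite hd.
  by case: (par P _) => //= u; rewrite permK.
split; last exact: srforest_graph_of.
rewrite !gcode_graph_of //; last by exists d.
apply: (pcode_embed (f := s) (e := fun=> false)) => // [|v u /sgE ->].
  by exists (s^-1)%g; [apply: permK | apply: permKV].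
by rewrite addbF.
Qed.

Definition isoclass g : {set srgraph n} := [set h in srforests n | iso g h].

Lemma SF_E C :
  reflect (exists2 g, g \in srforests n & C = isoclass g) (C \in SF n).
Proof. exact: imsetP. Qed.

Lemma isoclass_id g : g \in srforests n -> g \in isoclass g.
Proof. by move=> fg; rewrite inE fg iso_refl. Qed.

Lemma isoclass_eq g h : iso g h -> isoclass g = isoclass h.
Proof.
move=> gh; apply/setP => k; rewrite !inE; apply: andb_id2l => _.
apply/idP/idP; last exact: iso_trans gh.
by apply: iso_trans; apply: iso_sym.
Qed.

Definition class_code (C : {set srgraph n}) : code :=
  if [pick g in C] is Some g then gcode g else CNil.

Lemma class_code_isoclass g : g \in srforests n ->
  class_code (isoclass g) = gcode g.
Proof.
move=> fg; rewrite /class_code; case: pickP => [h|/(_ g)]; last by rewrite isoclass_id.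
by rewrite inE => /andP[_ /(gcode_iso fg)[]].
Qed.

Lemma flip_step_code C D : flip_step C D -> class_code C = class_code D.
Proof.
case/and3P => /SF_E[g fg ->] /SF_E[h fh ->] /existsP[g' /andP[]].
rewrite inE => /andP[fg' /(gcode_iso fg)[g'E _]] /existsP[i].
rewrite inE => /andP[_ /(gcode_iso fh)[g''E _]].
rewrite !class_code_isoclass // -g'E -g''E.
have /srforestP[P [hP ->]] := fg'.
rewrite flip_graph_of // !gcode_graph_of // ?pcode_toggle //.
Qed.

Definition toggles (s : seq 'I_n) (P : pforest 'I_n) : pforest 'I_n :=
  foldr (@toggle n) P s.

Lemma par_toggles s P : par (toggles s P) = par P.
Proof. by elim: s. Qed.

Lemma sg_toggles s P v u : uniq s -> par P v = Some u ->
  sg (toggles s P) v = sg P v (+) (u \in s).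
Proof.
move=> us E; elim: s us => [|i s IHs] /=; first by rewrite addbF.
move=> /andP[si /IHs ->]; rewrite par_toggles E inE -addbA; congr (_ (+) _).
by rewrite (inj_eq Some_inj); case: eqP => [->|_]; rewrite ?(negPf si) ?addbF.
Qed.

Lemma flip_equiv_toggles s P : (exists d, depth P d) ->
  flip_equiv (isoclass (graph_of P)) (isoclass (graph_of (toggles s P))).
Proof.
move=> hP; elim: s => [|i s IHs] /=; first exact: connect0.
apply: connect_trans IHs (connect1 _); apply/orP; left.
have hPs : exists d, depth (toggles s P) d.
  by case: hP => d hd; exists d => v; rewrite par_toggles.
have fs := srforest_graph_of hPs.
have fi : graph_of (toggle i (toggles s P)) \in srforests n.
  by apply: srforest_graph_of; case: hPs => d hd; exists d.
apply/and3P; split; try by apply/SF_E; eexists; last by [].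
apply/existsP; exists (graph_of (toggles s P)); rewrite isoclass_id //=.
by apply/existsP; exists i; rewrite flip_graph_of // isoclass_id.
Qed.

(** Reversals and isomorphisms preserve codes; conversely, [pcode_complete] gives
the vertices at which to reverse the signs before applying an isomorphism. *)
Lemma flip_equivE : {in SF n &, forall C D,
  flip_equiv C D = (class_code C == class_code D)}.
Proof.
move=> C D CS DS; apply/idP/eqP => [|].
  move=> /connectP[p + ->]; elim: p C {CS DS} => //= E p IHp C /andP[CE /IHp <-].
  by case/orP: CE => /flip_step_code.
have [g /srforestP[P [hP ->]] ->] := SF_E _ CS.
have [h /srforestP[Q [hQ ->]] ->] := SF_E _ DS.
rewrite !class_code_isoclass ?srforest_graph_of // !gcode_graph_of // => PQ.
have [d hd] := hP; have nn : (#|'I_n| <= n)%N by rewrite card_ord.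
have [f [e [parE sgE]]] := pcode_complete hd nn PQ.
pose s := enum [pred u | e u].
suff /isoclass_eq <- : iso (graph_of (toggles s P)) (graph_of Q).
  exact: flip_equiv_toggles.
apply: (iso_graph_of (f := f)) => [v|v u]; rewrite par_toggles // => E.
by rewrite (sg_toggles _ E) ?enum_uniq // mem_enum (sgE _ _ E).
Qed.

Definition forest_codes : seq code := undup [seq gcode g | g in srforests n].

Lemma mem_forest_codes x : (x \in forest_codes) = canon x && (csize x == n).
Proof.
rewrite mem_undup; apply/imageP/andP => [[g fg ->]|[cx /eqP sx]].
  split; first exact: canon_pcode.
  have [d hd] := depth_orient fg.
  by rewrite (csize_pcode hd) card_ord.
have [P [hP xE]] := canon_attained_ord cx; subst n.
exists (graph_of P); first exact: srforest_graph_of.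
by rewrite gcode_graph_of.
Qed.

Lemma card_SF_classes : #|SF_classes n| = size forest_codes.
Proof.
pose block c := [set C in SF n | class_code C == c].
have codeP c : c \in forest_codes -> exists2 C, C \in SF n & class_code C = c.
  rewrite mem_undup => /imageP[g fg ->]; exists (isoclass g).
    by apply/SF_E; exists g.
  exact: class_code_isoclass.
have uniq_blocks : uniq [seq block c | c <- forest_codes].
  rewrite map_inj_in_uniq ?undup_uniq // => c c' /codeP[C CS Cc] _ /setP/(_ C).
  by rewrite !inE CS Cc eqxx /= => /esym/eqP.
rewrite -(size_map block) -(card_uniqP uniq_blocks); apply: eq_card => X.
apply/imsetP/mapP => [[C CS ->]|[c /codeP[C CS <-] ->]].
  exists (class_code C).
    have [g fg ->] := SF_E _ CS.
    by rewrite class_code_isoclass // mem_undup image_f.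
  apply/setP => D; rewrite !inE; apply: andb_id2l => DS.
  by rewrite flip_equivE // eq_sym.
exists C => //; apply/setP => D; rewrite !inE; apply: andb_id2l => DS.
by rewrite flip_equivE // eq_sym.
Qed.

End Classes.

Theorem theorem1p1 :
  F =1
  fps_exp
    (fps_sum 1 (fun k : nat =>
       fps_scale ((2 * k)%N%:R)^-1
         (fps_mul (fps_monom k)
            (fps_add (fps_subst (2 * k) F)
                     (fps_pow (fps_subst k F) 2))))).
Proof.
apply: (functional_equation (fo := forest_codes)) => [n|n x|n].
- exact: undup_uniq.
- exact: mem_forest_codes.
by rewrite /F card_SF_classes.
Qed.
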